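(* Let $1\le p<\infty$, $a>-1$, and let $\phi$ be a measurable function on $[0,\infty)$ satisfying $$\int_0^\infty |\phi(t)|\,t^{\frac{a+1}{p}-1}\,dt<\infty .$$ Then $$\sup_{\xi\in\mathbb{R}}\left|\widehat{k_{a,p}}(\xi)\right|\le\|\mathcal{H}_\phi\|_{H^p_{|\cdot|^a}},$$ where $\|\mathcal{H}_\phi\|_{H^p_{|\cdot|^a}}$ is the operator norm of the Hausdorff operator $\mathcal{H}_\phi$ on $H^p_{|\cdot|^a}(\mathbb{U})$ and $$\widehat{k_{a,p}}(\xi)=\int_0^\infty \phi(t)\,t^{\frac{a+1}{p}}\,\frac{dt}{t^{1+i\xi}},\qquad \xi\in\mathbb{R}.$$
   Context: $\mathbb{U}=\{z=x+iy\in\mathbb{C}: y>0\}$ is the upper half-plane. For $1\le p<\infty$ and $a>-1$, the power weighted Hardy space $H^p_{|\cdot|^a}(\mathbb{U})$ is the Banach space of all analytic functions $f$ on $\mathbb{U}$ with $$\|f\|_{H^p_{|\cdot|^a}}=\sup_{y>0}\left(\int_{\mathbb{R}}|f(x+iy)|^p|x|^a\,dx\right)^{1/p}<\infty .$$ For a measurable kernel $\phi$, the Hausdorff operator on holomorphic functions $f$ on $\mathbb{U}$ is $$\mathcal{H}_\phi f(z)=\int_0^\infty f\left(\frac{z}{t}\right)\frac{\phi(t)}{t}\,dt,\qquad z\in\mathbb{U}.$$ Under the integrability hypothesis on $\phi$ in the statement, $\mathcal{H}_\phi$ is a bounded operator on $H^p_{|\cdot|^a}(\mathbb{U})$ (a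 known result). *)

(* Defs.v *)
From HB Require Import structures.
From mathcomp Require Import all_boot all_order all_algebra.
From mathcomp Require Export complex.
From mathcomp Require Import all_classical all_reals all_analysis.

Set Implicit Arguments.
Unset Strict Implicit.
Unset Printing Implicit Defensive.

Import Order.TTheory GRing.Theory Num.Theory.
Import numFieldNormedType.Exports.

Local Open Scope classical_set_scope.
Local Open Scope ring_scope.

Definition upper_half_plane {R : realType} : set R[i] :=
  [set z | 0 < complex.Im z].

(* The norm of [R[i]] takes its values in [R[i]]; this is the modulus as a
   real number. *)
Definition cabs {R : realType} (z : R[i]) : R := ComplexField.Normc.normc z.

(* [R[i]] is seen as a normed space over the field [R[i]] itself, so that
   derivability in the direction [1] is complex differentiability. *)
Definition holomorphic_on {R : realType} (U : set R[i]) (f : R[i] -> R[i]) :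
    Prop :=
  forall z, U z -> derivable (f : R[i]^o -> R[i]^o) z 1.

Definition cexp {R : realType} (z : R[i]) : R[i] :=
  ((expR (complex.Re z))%:C * (cos (complex.Im z) +i* sin (complex.Im z)))%C.

(* The principal power t^s; meaningful for t > 0 only. *)
Definition cpow {R : realType} (t : R) (s : R[i]) : R[i] :=
  cexp (s * (ln t)%:C)%C.

(* The real line with its Lebesgue measurable sets (those measurable in the
   sense of Caratheodory, not merely the Borel sets). *)
Definition leb_line (R : realType) :=
  caratheodory_type ((wlength (@idfun R))^*)%mu.

Definition cmeasurable {d} {T : measurableType d} {R : realType}
    (D : set T) (f : T -> R[i]) : Prop :=
  measurable_fun D (fun t => complex.Re (f t)) /\
  measurable_fun D (fun t => complex.Im (f t)).

Definition cintegral {d} {T : measurableType d} {R : realType}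
    (mu : {measure set T -> \bar R}) (D : set T) (f : T -> R[i]) : R[i] :=
  ((\int[mu]_(t in D) complex.Re (f t))%R
   +i* (\int[mu]_(t in D) complex.Im (f t))%R)%C.

Definition hardy_norm {R : realType} (p a : R) (f : R[i] -> R[i]) : \bar R :=
  ereal_sup [set ((\int[lebesgue_measure]_(x in setT)
                     (cabs (f (x +i* y)%C) `^ p * `|x| `^ a)%:E) `^ p^-1)%E
            | y in [set y : R | 0 < y]].

Definition hardy {R : realType} (p a : R) : set (R[i] -> R[i]) :=
  [set f | holomorphic_on upper_half_plane f /\ (hardy_norm p a f < +oo)%E].

Definition hausdorff {R : realType} (phi : R -> R[i]) (f : R[i] -> R[i])
    (z : R[i]) : R[i] :=
  cintegral completed_lebesgue_measure `]0, +oo[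
    (fun t : R => f (z / t%:C)%C * (phi t / t%:C)%C).

(* The operator norm of [T] on the Hardy space, as an extended real. *)
Definition hardy_opnorm {R : realType} (p a : R)
    (T : (R[i] -> R[i]) -> (R[i] -> R[i])) : \bar R :=
  ereal_sup [set hardy_norm p a (T f)
            | f in [set f | hardy p a f /\ (hardy_norm p a f <= 1)%E]].

Definition khat {R : realType} (p a : R) (phi : R -> R[i]) (xi : R) : R[i] :=
  cintegral completed_lebesgue_measure `]0, +oo[
    (fun t : R => phi t * (t `^ ((a + 1) / p))%:C / cpow t (1 +i* xi))%C.

(* Main.v *)
(* Write s = (a+1)/p.  The function z^(-s + i xi) is formally an eigenfunction of
   the Hausdorff operator with eigenvalue khat xi, but its p-th power integrals
   against |x|^a diverge logarithmically at 0 and at infinity.  The functions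
   f_eps(z) = (z + i eps)^(-s + i xi) / (1 - i z) belong to the Hardy space and
   their norms blow up as eps -> 0.  For eps/r <= |z| <= r with r small, dominated
   convergence gives |H f_eps(z) - khat xi f_eps(z)| <= eta |f_eps(z)|, while the
   part of the norm integrals of f_eps coming from the remaining z is bounded
   uniformly in eps and in the height of the line.  Normalising f_eps and choosing
   a line on which its norm is nearly attained gives
   |khat xi| - eta <= (1 + o(1)) ||H||. *)
Require Import Defs.
From HB Require Import structures.
From mathcomp Require Import all_boot all_order all_algebra.
From mathcomp Require Import all_classical all_reals all_analysis.
From mathcomp Require Import measurable_realfun.
From mathcomp Require Import ring lra.

Set Implicit Arguments.
Unset Strict Implicit.
Unset Printing Implicit Defensive.

Import Order.TTheory GRing.Theory Num.Theory.
Import numFieldNormedType.Exports.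

Local Open Scope classical_set_scope.
Local Open Scope ring_scope.

Local Arguments cabs : simpl never.

(** * Complex exponential and logarithm *)

Section ComplexPreliminaries.
Variable R : realType.
Implicit Types (z w h c : R[i]) (u v x y t : R).

(** For fixed t, the test function at z/t is t^(s - i xi) times its value at z, times a factor built
    from (z + i eps t)/(z + i eps) and (1 - iz)/(1 - iz/t). Both quotients tend to 1 as eps/|z| and
    |z| tend to 0, but not uniformly in t: hence the two sides of the window eps/r <= |z| <= r, and
    dominated convergence instead of an explicit rate. The Hardy norm is a supremum over horizontal
    lines, and the height of a nearly optimal line is not under control. So the window is cut out by
    |z| rather than |x|, and the mass outside it must be bounded for all heights at once. Near 0
    this bound is scale invariant: eps^(-(a+1)) |x|^a integrated over |x| <= eps/r is a multiple of
    r^(-(a+1)), free of eps. At infinity 1/(1 - iz) makes the integrand O(|x|^(-1-p)). At height eps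
    the integrand is at least c/x for eps <= x <= 1, so the p-th power of the norm is at least c
    log(1/eps), and the fixed outside mass becomes negligible. *)

Lemma normcE_cabs z : `|z| = (cabs z)%:C%C.
Proof. by []. Qed.

Lemma cabsE z : cabs z = Num.sqrt (complex.Re z ^+ 2 + complex.Im z ^+ 2).
Proof. by case: z. Qed.

Lemma cabs_ge0 z : 0 <= cabs z.
Proof. by rewrite cabsE sqrtr_ge0. Qed.

Lemma cabsM z w : cabs (z * w) = cabs z * cabs w.
Proof. exact: ComplexField.Normc.normcM. Qed.

Lemma cabsV z : cabs z^-1 = (cabs z)^-1.
Proof. exact: ComplexField.Normc.normcV. Qed.

Lemma cabsN z : cabs (- z) = cabs z.
Proof. exact: normcN. Qed.

Lemma cabsD z w : cabs (z + w) <= cabs z + cabs w.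
Proof. exact: le_normcD. Qed.

Lemma cabsBC z w : cabs (z - w) = cabs (w - z).
Proof. by rewrite -opprB cabsN. Qed.

Lemma cabs_real x : cabs (x%:C%C) = `|x|.
Proof. by rewrite cabsE /= expr0n /= addr0 sqrtr_sqr. Qed.

Lemma cabs0 : cabs (0 : R[i]) = 0.
Proof. exact: ComplexField.Normc.normc0. Qed.

Lemma cabs1 : cabs (1 : R[i]) = 1.
Proof. exact: ComplexField.Normc.normc1. Qed.

Lemma cabs_sqr z : cabs z ^+ 2 = complex.Re z ^+ 2 + complex.Im z ^+ 2.
Proof. by rewrite cabsE sqr_sqrtr // addr_ge0 ?sqr_ge0. Qed.

Lemma ler_sqrW x y : 0 <= y -> x ^+ 2 <= y ^+ 2 -> x <= y.
Proof.
move=> y0 h; have [x0|x0] := leP 0 x; last exact: le_trans (ltW x0) y0.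
by rewrite -(@ler_pXn2r _ 2) // nnegrE.
Qed.

Lemma le_Re_cabs z : `|complex.Re z| <= cabs z.
Proof.
by apply: ler_sqrW; rewrite ?cabs_ge0// cabs_sqr real_normK ?num_real// lerDl sqr_ge0.
Qed.

Lemma le_Im_cabs z : `|complex.Im z| <= cabs z.
Proof.
by apply: ler_sqrW; rewrite ?cabs_ge0// cabs_sqr real_normK ?num_real// lerDr sqr_ge0.
Qed.

Lemma cabs_le_ReIm z : cabs z <= `|complex.Re z| + `|complex.Im z|.
Proof.
apply: ler_sqrW; first by rewrite addr_ge0.
rewrite cabs_sqr sqrrD !real_normK ?num_real//.
by rewrite addrAC lerDl mulrn_wge0// mulr_ge0.
Qed.

Lemma cabs_gt0 z : (0 < cabs z) = (z != 0).
Proof.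
rewrite lt_neqAle cabs_ge0 andbT eq_sym; congr negb; apply/eqP/eqP => [|->].
  exact: ComplexField.Normc.eq0_normc.
exact: cabs0.
Qed.

Lemma upper_neq0 z : 0 < complex.Im z -> z != 0.
Proof. by case: z => x y /= y0; rewrite eq_complex /= negb_and (gt_eqF y0) orbT. Qed.

(** Both [cexp] and [clog] are differentiated through a second-order remainder estimate, without
    recourse to the Cauchy-Riemann equations. *)
Lemma derivable_of_quadratic_error (f : R[i] -> R[i]) z l (C d : R) :
  0 < d -> 0 < C ->
  (forall h, cabs h < d ->
     cabs (f (h + z) - f z - l * h) <= C * cabs h ^+ 2) ->
  derivable (f : R[i]^o -> R[i]^o) z 1.
Proof.
move=> d0 C0 H; apply/cvg_ex; exists l.
apply/cvgrPdist_le => e e0.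
(* In the order of [R[i]] a positive element is real, so [complex.Re e] is the real tolerance. *)
have eE : e = (complex.Re e)%:C%C.
  by move: e0; case: e => a b; rewrite ltcE /= => /andP[/eqP -> _].
have e0' : 0 < complex.Re e by move: e0; rewrite ltcE => /andP[].
near=> h.
have h0 : h != 0 by near: h; exact: nbhs_dnbhs_neq.
have hd : cabs h < Num.min d (complex.Re e / C).
  rewrite -ltcR -normcE_cabs; near: h.
  apply: dnbhs0_lt; rewrite ltcR lt_min d0 divr_gt0//.
move: hd; rewrite lt_min => /andP[hd hC].
rewrite eE normcE_cabs lecR.
have -> : l - h^-1 *: ((f \o shift z) (h *: 1) - f z) =
  - (f (h + z) - f z - l * h) / h.
  rewrite /GRing.scale/= mulr1.
  by field.
rewrite cabsM cabsN cabsV ler_pdivrMr ?cabs_gt0//.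
apply: le_trans (H _ hd) _.
rewrite expr2 mulrA ler_wpM2r ?cabs_ge0//.
by rewrite mulrC -ler_pdivlMr// ltW.
Unshelve. all: by end_near. Qed.

Lemma cexpD z w : cexp (z + w) = cexp z * cexp w.
Proof.
case: z => a b; case: w => c d; rewrite /cexp /= expRD cosD sinD; simpc.
by apply/eqP; rewrite eq_complex /=; apply/andP; split; apply/eqP; ring.
Qed.

Lemma cabs_cexp z : cabs (cexp z) = expR (complex.Re z).
Proof.
rewrite /cexp cabsM cabs_real ger0_norm ?expR_ge0// cabsE /= cos2Dsin2 sqrtr1.
by rewrite mulr1.
Qed.

Lemma cexp0 : cexp (0 : R[i]) = 1.
Proof. by rewrite /cexp /= expR0 cos0 sin0; simpc. Qed.

Lemma cexp_neq0 z : cexp z != 0.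
Proof. by rewrite -cabs_gt0 cabs_cexp expR_gt0. Qed.

Lemma cexpN z : cexp (- z) = (cexp z)^-1.
Proof.
apply: (mulfI (cexp_neq0 z)); rewrite -cexpD subrr cexp0 divff //.
exact: cexp_neq0.
Qed.

Lemma cexpB z w : cexp (z - w) = cexp z / cexp w.
Proof. by rewrite cexpD cexpN. Qed.

(** Mean value inequality based at 0. It is applied in turn to sin, cos and sin t - t; each estimate
    bounds the derivative that occurs in the next. *)
Lemma norm_sub0_le (f df : R -> R) (M : R) y :
  (forall t, is_derive t (1 : R) f (df t)) ->
  (forall t, `|t| <= `|y| -> `|df t| <= M) ->
  `|f y - f 0| <= M * `|y|.
Proof.
move=> fdf dfM.
have cf : forall A, {within A, continuous f}.
  by move=> A; apply: continuous_subspaceT => t; apply/differentiable_continuous;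
    apply/derivable1_diffP; exact: (@ex_derive _ _ _ _ _ _ _ (fdf t)).
have [y0|y0] := leP 0 y.
  have [c cI ->] := MVT_segment y0 (fun t _ => fdf t) (cf _).
  rewrite subr0 normrM ler_wpM2r// dfM//.
  by move: cI; rewrite in_itv /= => /andP[c0 cy]; rewrite !ger0_norm.
have [c cI] := MVT_segment (ltW y0) (fun t _ => fdf t) (cf _).
rewrite distrC => ->.
rewrite sub0r normrM normrN ler_wpM2r// dfM//.
move: cI; rewrite in_itv /= => /andP[c0 cy]; rewrite !ler0_norm//; last exact: ltW.
by rewrite lerN2.
Qed.

Lemma norm_sin_le v : `|sin v| <= `|v|.
Proof.
have := @norm_sub0_le sin cos 1 v (fun t => is_derive_sin t) (fun t _ => cos_max t).
by rewrite sin0 subr0 mul1r.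
Qed.

Lemma norm_cosB1_le v : `|cos v - 1| <= `|v| ^+ 2.
Proof.
have H t : `|t| <= `|v| -> `|- sin t| <= `|v|.
  by move=> tv; rewrite normrN (le_trans (norm_sin_le t)).
have := @norm_sub0_le cos (fun t => - sin t) `|v| v (fun t => is_derive_cos t) H.
by rewrite cos0 -expr2.
Qed.

Lemma norm_sinB_le v : `|v| <= 1 -> `|sin v - v| <= `|v| ^+ 2.
Proof.
move=> v1.
have H t : `|t| <= `|v| -> `|cos t - 1| <= `|v|.
  move=> tv; rewrite (le_trans (norm_cosB1_le t))// expr2.
  rewrite -[leRHS]mulr1 ler_pM//; exact: le_trans v1.
have D t : is_derive t (1 : R) (fun t => sin t - t) (cos t - 1).
  exact: is_deriveB.
have := @norm_sub0_le _ _ `|v| v D H.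
by rewrite sin0 subr0 subr0 -expr2.
Qed.

(** Convexity suffices: e^u >= 1 + u, and e^(-u) >= 1 - u gives e^u <= 1/(1 - u), whence 0 <= e^u -
    1 - u <= u^2/(1 - u). *)
Lemma norm_expRB1D_le u : `|u| <= 2^-1 -> `|expR u - 1 - u| <= 2 * `|u| ^+ 2.
Proof.
move=> u1.
have /andP[ul ur] : - 2^-1 <= u <= 2^-1 by rewrite -ler_norml.
have e1 := expR_ge1Dx u; have e2 := expR_ge1Dx (- u).
rewrite real_normK ?num_real// ger0_norm; last by lra.
have e0 := expR_gt0 u.
move: e2; rewrite expRN => e2.
have : expR u * (1 - u) <= 1 by rewrite mulrC -ler_pdivlMr// div1r.
nra.
Qed.

(** With z = u + iv, both components are rearranged so that every summand is of second order. The
    two bounds add up to 4|u|^2 + |u||v| + 3|v|^2, so 10 is a comfortable constant. *)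
Lemma cexp_quadratic z : cabs z <= 2^-1 ->
  cabs (cexp z - 1 - z) <= 10 * cabs z ^+ 2.
Proof.
move=> z1.
have u1 : `|complex.Re z| <= 2^-1 := le_trans (le_Re_cabs z) z1.
have v1 : `|complex.Im z| <= 2^-1 := le_trans (le_Im_cabs z) z1.
apply: le_trans (cabs_le_ReIm _) _; rewrite cabs_sqr.
case: z z1 u1 v1 => u v _ /= u1 v1; rewrite !mul0r !subr0 !addr0.
have cu := norm_cosB1_le v; have su : `|sin v - v| <= `|v| ^+ 2 by apply: norm_sinB_le; lra.
have eu := norm_expRB1D_le u1.
have cv := cos_max v.
have -> : expR u * cos v - 1 - u = (expR u - 1 - u) * cos v + (1 + u) * (cos v - 1)
  by ring.
have -> : expR u * sin v - v =
   (expR u - 1 - u) * sin v + u * sin v + (sin v - v) by ring.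
have s1 := sin_max v; have s2 := norm_sin_le v.
have n1 : `|1 + u| <= 2 by rewrite (le_trans (ler_normD _ _))// normr1; lra.
have b1 : `|(expR u - 1 - u) * cos v + (1 + u) * (cos v - 1)| <=
   2 * `|u| ^+ 2 + 2 * `|v| ^+ 2.
  rewrite (le_trans (ler_normD _ _))// !normrM lerD//.
    by rewrite -[leRHS]mulr1 ler_pM.
  by rewrite ler_pM.
have b2 : `|(expR u - 1 - u) * sin v + u * sin v + (sin v - v)| <=
   2 * `|u| ^+ 2 + `|u| * `|v| + `|v| ^+ 2.
  rewrite (le_trans (ler_normD _ _))// lerD//.
  rewrite (le_trans (ler_normD _ _))// !normrM lerD//.
    by rewrite -[leRHS]mulr1 ler_pM.
  by rewrite ler_pM.
move: b1 b2; rewrite -(real_normK (num_real u)) -(real_normK (num_real v)).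
move: `|u| `|v| => U V; set X := `|_|; set Y := `|_|.
have := sqr_ge0 (U - V); rewrite !expr2; nra.
Qed.

Lemma derivable_cexp z : derivable (cexp : R[i]^o -> R[i]^o) z 1.
Proof.
apply: (@derivable_of_quadratic_error _ z (cexp z) (10 * cabs (cexp z)) 2^-1).
- by lra.
- by rewrite mulr_gt0// cabs_gt0 cexp_neq0.
- move=> h h1; rewrite cexpD.
  have -> : cexp h * cexp z - cexp z - cexp z * h = cexp z * (cexp h - 1 - h) by ring.
  rewrite cabsM mulrAC mulrC ler_wpM2r ?cabs_ge0// cexp_quadratic// ltW//.
Qed.

(* On the upper half plane this is the branch with argument in (0, pi); the
   values elsewhere are meaningless. *)
Definition clog z : R[i] :=
  (ln (cabs z) +i* (pi / 2 - atan (complex.Re z / complex.Im z)))%C.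

Lemma cexp_clog z : 0 < complex.Im z -> cexp (clog z) = z.
Proof.
move=> y0; rewrite /cexp /clog /= lnK; last first.
  by rewrite posrE cabs_gt0 upper_neq0.
case: z y0 => x y /= y0.
rewrite cosB sinB cos_pihalf sin_pihalf !mul0r !mul1r add0r subr0.
have c0 : cos (atan (x / y)) != 0.
  by rewrite cos_atan invr_eq0 sqrtr_eq0 -ltNge; have := sqr_ge0 (x / y); lra.
have -> : sin (atan (x / y)) = x / y * cos (atan (x / y)).
  by rewrite -{2}(atanK (x / y)) /tan divfK.
have -> : cos (atan (x / y)) = y / cabs (x +i* y)%C.
  rewrite cos_atan -[X in _ = X / _]invrK -invfM; congr (_^-1).
  rewrite cabsE /= -[in RHS](@ger0_norm _ y^-1) ?invr_ge0 ?ltW//.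
  rewrite -sqrtr_sqr -sqrtrM ?sqr_ge0//; congr (Num.sqrt _).
  by rewrite !expr2; field; rewrite gt_eqF.
have : cabs (x +i* y)%C != 0 by rewrite gt_eqF// cabs_gt0 upper_neq0.
move: (cabs _) => r r0; simpc.
congr (_ +i* _)%C; field; rewrite ?r0 ?gt_eqF//.
Qed.

Lemma norm_diff_le_segment (f df : R -> R) (M : R) :
  (forall t, 0 <= t <= 1 -> is_derive t (1 : R) f (df t)) ->
  (forall t, 0 <= t <= 1 -> `|df t| <= M) ->
  `|f 1 - f 0| <= M.
Proof.
move=> fdf dfM.
have fdf' t : t \in `]0, 1[ -> is_derive t (1 : R) f (df t).
  by rewrite in_itv /= => /andP[t0 t1]; apply: fdf; rewrite !ltW.
have cf : {within `[0, 1], continuous f}.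
  apply: derivable_within_continuous => t; rewrite in_itv /= => t01.
  exact: (@ex_derive _ _ _ _ _ _ _ (fdf t t01)).
have [c cI ->] := MVT_segment ler01 fdf' cf.
by rewrite subr0 mulr1 dfM//; move: cI; rewrite in_itv.
Qed.

Lemma cauchy_schwarz2 x y u v : `|x * u + y * v| <= cabs (x +i* y)%C * cabs (u +i* v)%C.
Proof.
apply: ler_sqrW; first by rewrite mulr_ge0 ?cabs_ge0.
rewrite exprMn !cabs_sqr /= real_normK ?num_real//.
by have := sqr_ge0 (x * v - y * u); rewrite !expr2; nra.
Qed.

Lemma ln_cabs z : z != 0 ->
  ln (cabs z) = 2^-1 * ln (complex.Re z ^+ 2 + complex.Im z ^+ 2).
Proof.
move=> z0; rewrite -cabs_sqr lnXn ?cabs_gt0//; by field.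
Qed.

(* [clog] has derivative [1 / z], of modulus at most [1 / m] on the segment. *)
Lemma clog_lipschitz z w (m : R) : 0 < m ->
  0 < complex.Im z -> 0 < complex.Im w ->
  (forall t, 0 <= t <= 1 -> m <= cabs (z + t%:C%C * (w - z))) ->
  `|complex.Re (clog w - clog z)| <= cabs (w - z) / m /\
  `|complex.Im (clog w - clog z)| <= cabs (w - z) / m.
Proof.
move=> m0 z0 w0 Hm.
have z0' := upper_neq0 z0; have w0' := upper_neq0 w0.
case: z z0 z0' Hm => x y /= y0 z0; case: w w0 w0' => x' y' /= y0' w0 Hm.
set dx := x' - x; set dy := y' - y.
have Y0 t : 0 <= t <= 1 -> 0 < y + t * dy.
  move=> /andP[t0 t1]; rewrite /dy.
  have [->|t0'] := eqVneq t 0; first by rewrite mul0r addr0.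
  have tt : 0 < t by rewrite lt_neqAle eq_sym t0'.
  by nra.
have m_le t : 0 <= t <= 1 -> m <= cabs ((x + t * dx) +i* (y + t * dy))%C.
  by move=> /Hm; rewrite /dx /dy; simpc.
have N0 t : 0 <= t <= 1 -> 0 < (x + t * dx) ^+ 2 + (y + t * dy) ^+ 2.
  by move=> /Y0 Yt; rewrite ltr_wpDl ?sqr_ge0// exprn_gt0.
have dX t : is_derive t (1 : R) (fun t => x + t * dx) dx.
  by apply: is_derive_eq; rewrite /GRing.scale /=; ring.
have dY t : is_derive t (1 : R) (fun t => y + t * dy) dy.
  by apply: is_derive_eq; rewrite /GRing.scale /=; ring.
(* Along the segment, the derivatives of the logarithm of the modulus and of the arctangent are both
   inner products of the moving point with a vector of length |w - z|, divided by the squared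
   modulus. The vector is (dx, dy) in the first case and its quarter turn (-dy, dx) in the
   second. *)
have bound t p q : 0 <= t <= 1 -> cabs (p +i* q)%C = cabs (dx +i* dy)%C ->
  `|((x + t * dx) * p + (y + t * dy) * q) /
     ((x + t * dx) ^+ 2 + (y + t * dy) ^+ 2)| <= cabs (dx +i* dy)%C / m.
  move=> t01 e; rewrite normrM normfV (gtr0_norm (N0 t t01)) ler_pdivrMr ?N0//.
  apply: le_trans (cauchy_schwarz2 _ _ _ _) _; rewrite e.
  rewrite mulrC -mulrA ler_wpM2l ?cabs_ge0//.
  have := cabs_sqr ((x + t * dx) +i* (y + t * dy))%C; rewrite /= => <-.
  by rewrite ler_pdivlMl// expr2 ler_wpM2r ?cabs_ge0 ?m_le.
have ex : x + dx = x' by rewrite /dx; ring.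
have ey : y + dy = y' by rewrite /dy; ring.
split.
- rewrite /clog; simpc => /=; rewrite -[X in _ <= cabs X / m]/(dx +i* dy)%C !ln_cabs//=.
  have := @norm_diff_le_segment
    (fun t => 2^-1 * ln ((x + t * dx) ^+ 2 + (y + t * dy) ^+ 2))
    (fun t => ((x + t * dx) * dx + (y + t * dy) * dy) /
     ((x + t * dx) ^+ 2 + (y + t * dy) ^+ 2)) (cabs (dx +i* dy)%C / m).
  rewrite !mul0r !mul1r !addr0 ex ey; apply=> t t01; last exact: bound.
  have ? := is_derive1_ln (N0 t t01).
  apply: is_derive_eq.
  rewrite /GRing.scale /=; field; rewrite gt_eqF ?N0//.
- rewrite /clog; simpc => /=; rewrite -[X in _ <= cabs X / m]/(dx +i* dy)%C.
  have -> : pi / 2 - atan (x' / y') + (atan (x / y) - pi / 2) =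
    - (atan (x' / y') - atan (x / y)) by ring.
  rewrite normrN.
  have := @norm_diff_le_segment
    (fun t => atan ((x + t * dx) / (y + t * dy)))
    (fun t => ((x + t * dx) * (- dy) + (y + t * dy) * dx) /
     ((x + t * dx) ^+ 2 + (y + t * dy) ^+ 2)) (cabs (dx +i* dy)%C / m).
  rewrite !mul0r !mul1r !addr0 ex ey; apply=> t t01; last first.
    by apply: bound => //; rewrite !cabsE /= sqrrN addrC.
  have ? : is_derive t (1 : R) (fun t => (y + t * dy)^-1) (- (y + t * dy) ^- 2 *: dy).
    by apply: is_deriveV; rewrite gt_eqF ?Y0.
  apply: is_derive_eq.
  rewrite /GRing.scale /=; field; rewrite ?(gt_eqF (N0 t t01)) ?(gt_eqF (Y0 t t01))//.
Qed.

(** The increment k of [clog] satisfies e^k = 1 + h/z exactly, and the Lipschitz bound with m = y/2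
    gives |k| <= 4|h|/y. The quadratic estimate for [cexp] at k then bounds |k - h/z| by 10|k|^2 <=
    160|h|^2/y^2; the radius y/16 keeps |k| below 1/2. *)
Lemma derivable_clog z : 0 < complex.Im z ->
  derivable (clog : R[i]^o -> R[i]^o) z 1.
Proof.
move=> z0; set y := complex.Im z in z0.
have zn := upper_neq0 z0.
apply: (@derivable_of_quadratic_error _ z z^-1 (160 / y ^+ 2) (y / 16)).
- by rewrite divr_gt0.
- by rewrite divr_gt0// exprn_gt0.
move=> h hy.
have seg t : 0 <= t <= 1 -> y / 2 <= complex.Im (z + t%:C%C * h).
  move=> /andP[t0 t1].
  have : `|complex.Im h| <= y / 16 by rewrite (le_trans (le_Im_cabs h)) ?ltW.
  rewrite ler_norml => /andP[h1 h2].
  have -> : complex.Im (z + t%:C%C * h) = y + t * complex.Im h.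
    by rewrite /y; case: (z) => a b; case: (h) => c d; simpc.
  nra.
have hz0 : 0 < complex.Im (h + z).
  have := seg 1; rewrite mul1r addrC ler01 lexx => /(_ erefl); lra.
have y2 : 0 < y / 2 by rewrite divr_gt0.
have [] := @clog_lipschitz z (h + z) (y / 2) y2 z0 hz0.
  move=> t /seg; rewrite addrK => h1; rewrite (le_trans h1)//.
  by rewrite (le_trans (ler_norm _)) ?le_Im_cabs.
rewrite addrK; set k := clog _ - clog _ => k1 k2.
have kh : cabs k <= 4 * cabs h / y.
  rewrite (le_trans (cabs_le_ReIm _))// (le_trans (lerD k1 k2))//.
  by rewrite le_eqVlt; apply/orP; left; apply/eqP; field; rewrite gt_eqF.
have k2' : cabs k <= 2^-1.
  rewrite (le_trans kh)// ler_pdivrMr//; lra.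
have ek : cexp k = 1 + z^-1 * h.
  by rewrite /k cexpB !cexp_clog// mulrDl divff// addrC mulrC.
have := cexp_quadratic k2'; rewrite ek.
have -> : 1 + z^-1 * h - 1 - k = - (k - z^-1 * h) by ring.
rewrite cabsN => /le_trans; apply.
have -> : 160 / y ^+ 2 * cabs h ^+ 2 = 10 * (4 * cabs h / y) ^+ 2.
  by field; rewrite gt_eqF.
by rewrite ler_wpM2l// ler_pXn2r// nnegrE ?cabs_ge0// (le_trans _ kh) ?cabs_ge0.
Qed.

End ComplexPreliminaries.
(** * Integrals of powers *)

Section RealIntegrals.
Variable R : realType.
Local Notation leb := (@lebesgue_measure R).
Implicit Types (a b p q u v r x : R).

(* No measurability is assumed, since an integral of a nonnegative function is a
   supremum over the simple functions below it; this avoids proving that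
   [hausdorff phi f] is measurable on horizontal lines. *)
Lemma ge0_integral_mono d (T : measurableType d) (mu : {measure set T -> \bar R})
    (D1 D2 : set T) (f1 f2 : T -> \bar R) :
  (forall t, D1 t -> (0 <= f1 t)%E) -> (forall t, D2 t -> (0 <= f2 t)%E) ->
  (forall t, D1 t -> D2 t /\ (f1 t <= f2 t)%E) ->
  (\int[mu]_(t in D1) f1 t <= \int[mu]_(t in D2) f2 t)%E.
Proof.
move=> f10 f20 f12; rewrite !ge0_integralE//.
apply: ge_ereal_sup => _ [h /= hf <-].
apply: ereal_sup_ubound; exists h => //= t; apply: le_trans (hf t) _.
rewrite !patchE; case: ifPn => [/set_mem /f12[D2t f12t]|_].
  by rewrite mem_set.
by case: ifPn => // /set_mem /f20.
Qed.

Lemma integral_powR u v b : 0 < u -> u < v -> b + 1 != 0 ->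
  (\int[leb]_(x in `[u, v]) (x `^ b)%:E)%E =
  ((v `^ (b + 1) - u `^ (b + 1)) / (b + 1))%:E.
Proof.
move=> u0 uv b1.
have D x : 0 < x -> is_derive x (1 : R) (fun x => (b + 1)^-1 * x `^ (b + 1)) (x `^ b).
  move=> x0; have ? := is_derive1_powR (b + 1) x0.
  apply: is_derive_eq; rewrite addrK /GRing.scale /= mulrA mulVf ?mul1r//.
have C x : 0 < x -> {for x, continuous (fun x : R => x `^ b)}.
  move=> x0; apply: differentiable_continuous; apply/derivable1_diffP.
  exact: (@ex_derive _ _ _ _ _ _ _ (is_derive1_powR b x0)).
have DC x : 0 < x -> {for x, continuous (fun x : R => (b + 1)^-1 * x `^ (b + 1))}.
  move=> x0; apply: differentiable_continuous; apply/derivable1_diffP.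
  exact: (@ex_derive _ _ _ _ _ _ _ (D x x0)).
rewrite (@continuous_FTC2 _ (fun x => x `^ b) (fun x => (b + 1)^-1 * x `^ (b + 1)))//.
- by rewrite -EFinB; congr EFin; field.
- apply: continuous_in_subspaceT => x; rewrite inE /= in_itv /= => /andP[ux _].
  by apply: C; exact: lt_le_trans ux.
- split.
  + move=> x; rewrite in_itv /= => /andP[ux _].
    exact: (@ex_derive _ _ _ _ _ _ _ (D x (lt_trans u0 ux))).
  + exact/cvg_at_right_filter/DC.
  + exact/cvg_at_left_filter/DC/(lt_trans u0).
- move=> x; rewrite in_itv /= => /andP[ux _].
  by rewrite derive1E; exact: (@derive_val _ _ _ _ _ _ _ (D x (lt_trans u0 ux))).
Qed.

Lemma integral_inv u v : 0 < u -> u < v ->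
  (\int[leb]_(x in `[u, v]) (x^-1)%:E)%E = (ln v - ln u)%:E.
Proof.
move=> u0 uv.
have D x : 0 < x -> is_derive x (1 : R) (@ln R) (x^-1) by move=> /is_derive1_ln.
have DC x : 0 < x -> {for x, continuous (@ln R)} by move=> /continuous_ln.
rewrite (@continuous_FTC2 _ (fun x => x^-1) (@ln R))//.
- apply: continuous_in_subspaceT => x; rewrite inE /= in_itv /= => /andP[ux _].
  by apply: inv_continuous; rewrite gt_eqF// (lt_le_trans u0).
- split.
  + move=> x; rewrite in_itv /= => /andP[ux _].
    exact: (@ex_derive _ _ _ _ _ _ _ (D x (lt_trans u0 ux))).
  + exact/cvg_at_right_filter/DC.
  + exact/cvg_at_left_filter/DC/(lt_trans u0).
- move=> x; rewrite in_itv /= => /andP[ux _].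
  by rewrite derive1E; exact: (@derive_val _ _ _ _ _ _ _ (D x (lt_trans u0 ux))).
Qed.

(** Reduces integrals with singularities at 0 or infinity to compact intervals inside the positive
    half-line, where the fundamental theorem of calculus applies. *)
Lemma even_integral_le (g : R -> R) (C : R) :
  measurable_fun setT g -> (forall x, 0 <= g x) -> (forall x, g (- x) = g x) ->
  (forall u v, 0 < u -> u < v -> (\int[leb]_(x in `[u, v]) (g x)%:E <= C%:E)%E) ->
  (\int[leb]_x (g x)%:E <= (2 * C)%:E)%E.
Proof.
move=> mg g0 gN gC.
have mg' (A : set R) : measurable_fun A (EFin \o g).
  by apply: measurable_funTS; exact/measurable_EFinP.
have half : (\int[leb]_(x in `]0%R, +oo[) (g x)%:E <= C%:E)%E.
  (* The right end is [n.+2] so that n = 0 gives [1, 2]: the bound [gC] requires a nondegenerate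
     interval. *)
  pose F (n : nat) := `[n.+1%:R^-1, n.+2%:R]%classic : set R.
  have FE : `]0%R, +oo[%classic = \bigcup_n F n.
    apply/seteqP; split => x.
      rewrite /= in_itv /= andbT => x0.
      have [n nx] : exists n : nat, Num.max x x^-1 < n%:R.
        by exists (Num.bound (Num.max x x^-1)); rewrite archi_boundP// le_max ltW.
      exists n => //=; rewrite /F /= in_itv /=.
      move: nx; rewrite gt_max => /andP[xn xVn].
      rewrite invf_ple ?posrE//; apply/andP; split.
        by rewrite (le_trans (ltW xVn))// ler_nat.
      by rewrite (le_trans (ltW xn))// ler_nat ltnW.
    move=> [n _]; rewrite /F /= !in_itv /= andbT => /andP[h _].
    by apply: lt_le_trans h; rewrite invr_gt0.
  have cv : (\int[leb]_(x in F i) (g x)%:E)%E @[i --> \oo] -->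
      (\int[leb]_(x in \bigcup_i F i) (g x)%:E)%E.
    apply: ge0_nondecreasing_set_cvg_integral => //.
  + move=> n m nm; rewrite subsetEset /F => x /=; rewrite !in_itv /= => /andP[h1 h2].
    apply/andP; split.
      by rewrite (le_trans _ h1)// lef_pV2 ?posrE// ler_nat.
    by rewrite (le_trans h2)// ler_nat !ltnS.
  + by move=> n; exact: measurable_itv.
  + by move=> n; exact: mg'.
  + by move=> n x _; rewrite lee_fin.
  rewrite FE; apply: (cvge_le _ cv).
  apply: nearW => n; apply: gC; first by rewrite invr_gt0.
  by rewrite (@le_lt_trans _ _ 1) ?ltr1n// invf_le1// ler1n.
have halfc : (\int[leb]_(x in `[0%R, +oo[) (g x)%:E <= C%:E)%E.
  by rewrite -integral_itv_obnd_cbnd//; exact: mg'.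
have neg : (\int[leb]_(x in `[0%R, +oo[) (g x)%:E =
            \int[leb]_(x in `]-oo, 0%R]) (g x)%:E)%E.
  rewrite (@ge0_integration_by_substitution0 _ (EFin \o g))//.
  by apply: eq_integral => x _ /=; rewrite gN.
rewrite (_ : setT = `]-oo, 0%R] `|` `]0%R, +oo[)%classic; last first.
  apply/seteqP; split => x //= _; rewrite !in_itv /= andbT.
  by case: (leP x 0) => ?; [left|right].
rewrite ge0_integral_setU//=; last 3 first.
- exact: mg'.
- by move=> x _; rewrite lee_fin.
- apply/disj_setPS => x [] /=; rewrite !in_itv /= andbT => h1 h2.
  by move: (lt_le_trans h2 h1); rewrite ltxx.
by rewrite -neg mulr_natl mulr2n EFinD leeD.
Qed.

Lemma integral_near0 a r : -1 < a -> 0 < r ->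
  (\int[leb]_x (if `|x| <= r then `|x| `^ a else 0)%:E <=
   (2 * (r `^ (a + 1) / (a + 1)))%:E)%E.
Proof.
move=> a1 r0; have a10 : 0 < a + 1 by lra.
apply: even_integral_le => [|x|x|u v u0 uv].
- apply: measurable_fun_ifT => //.
    by apply: measurable_fun_ler => //; exact: measurableT_comp.
  by apply: (measurableT_comp (measurable_powR a)) => //; exact: normr_measurable.
- by case: ifP => // _; rewrite powR_ge0.
- by rewrite normrN.
(* The given interval may lie entirely beyond [r]; lowering its left end to at most r/2 keeps
   [u', r] nondegenerate. *)
pose u' := Num.min u (r / 2).
have u'0 : 0 < u' by rewrite lt_min u0 divr_gt0.
have u'r : u' < r by rewrite gt_min; apply/orP; right; lra.
apply: (@le_trans _ _ (\int[leb]_(x in `[u', r]) (x `^ a)%:E)%E); last first.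
  rewrite integral_powR ?gt_eqF// lee_fin ler_wpM2r ?invr_ge0 ?(ltW a10)//.
  by rewrite lerBlDr lerDl powR_ge0.
rewrite [leLHS]integral_mkcond [leRHS]integral_mkcond.
apply: ge0_integral_mono => [x _|x _|x _].
- by rewrite patchE; case: ifPn => // _; case: ifP => // _; rewrite lee_fin powR_ge0.
- by rewrite patchE; case: ifPn => // _; rewrite lee_fin powR_ge0.
split=> //; rewrite !patchE; case: ifPn => [|_]; last first.
  by case: ifPn => // _; rewrite lee_fin powR_ge0.
rewrite inE /= in_itv /= => /andP[ux _].
have x0 : 0 < x := lt_le_trans u0 ux.
rewrite gtr0_norm//; case: ifPn => xr; last first.
  by case: ifPn => // _; rewrite lee_fin powR_ge0.
by rewrite ifT// inE /= in_itv /= xr andbT (le_trans _ ux)// ge_min lexx.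
Qed.

Lemma integral_far p : 0 < p ->
  (\int[leb]_x (if 1 < `|x| then `|x| `^ (- 1 - p) else 0)%:E <= (2 * p^-1)%:E)%E.
Proof.
move=> p0.
apply: even_integral_le => [|x|x|u v u0 uv].
- apply: measurable_fun_ifT => //.
    by apply: measurable_fun_ltr => //; exact: measurableT_comp.
  by apply: (measurableT_comp (measurable_powR _)) => //; exact: normr_measurable.
- by case: ifP => // _; rewrite powR_ge0.
- by rewrite normrN.
(* As before, this keeps [1, v'] nondegenerate when the given interval ends before 1. *)
pose v' := Num.max v 2.
have v'1 : 1 < v' by rewrite lt_max ltr1n orbT.
apply: (@le_trans _ _ (\int[leb]_(x in `[1%R, v']) (x `^ (- 1 - p))%:E)%E); last first.
  rewrite integral_powR//; last by rewrite lt_eqF//; lra.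
  rewrite powR1 lee_fin (_ : - 1 - p + 1 = - p); last by ring.
  rewrite invrN mulrN -mulNr opprB -[leRHS]mul1r ler_wpM2r ?invr_ge0 ?(ltW p0)//.
  by rewrite lerBlDr lerDl powR_ge0.
rewrite [leLHS]integral_mkcond [leRHS]integral_mkcond.
apply: ge0_integral_mono => [x _|x _|x _].
- by rewrite patchE; case: ifPn => // _; case: ifP => // _; rewrite lee_fin powR_ge0.
- by rewrite patchE; case: ifPn => // _; rewrite lee_fin powR_ge0.
split=> //; rewrite !patchE; case: ifPn => [|_]; last first.
  by case: ifPn => // _; rewrite lee_fin powR_ge0.
rewrite inE /= in_itv /= => /andP[ux xv].
have x0 : 0 < x := lt_le_trans u0 ux.
rewrite gtr0_norm//; case: ifPn => xr; last first.
  by case: ifPn => // _; rewrite lee_fin powR_ge0.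
by rewrite ifT// inE /= in_itv /= (ltW xr) /= (le_trans xv)// le_max lexx.
Qed.

End RealIntegrals.
(** * Complex-valued integrals *)

Section ComplexIntegrals.
Context {d : measure_display} {T : measurableType d} {R : realType}.
Implicit Types (D : set T) (f g : T -> R[i]).

Lemma eq_cmeasurable D f g : (forall t, D t -> f t = g t) ->
  cmeasurable D f -> cmeasurable D g.
Proof.
move=> fg [mr mi]; split.
- by apply: eq_measurable_fun mr => t /set_mem Dt; rewrite fg.
- by apply: eq_measurable_fun mi => t /set_mem Dt; rewrite fg.
Qed.

Lemma cmeasurable_cst D (c : R[i]) : cmeasurable D (fun=> c).
Proof. by split; exact: measurable_cst. Qed.

Lemma cmeasurable_real D (f : T -> R) : measurable_fun D f ->
  cmeasurable D (fun t => (f t)%:C%C).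
Proof. by move=> mf; split => //=; exact: measurable_cst. Qed.

Lemma cmeasurableD D f g : cmeasurable D f -> cmeasurable D g ->
  cmeasurable D (fun t => f t + g t).
Proof.
move=> [fr fi] [gr gi]; split.
- rewrite (_ : (fun t => _) = (fun t => complex.Re (f t) + complex.Re (g t))).
    exact: measurable_funD.
  by apply/funext => t; case: (f t) (g t) => ? ? [].
- rewrite (_ : (fun t => _) = (fun t => complex.Im (f t) + complex.Im (g t))).
    exact: measurable_funD.
  by apply/funext => t; case: (f t) (g t) => ? ? [].
Qed.

Lemma cmeasurableM D f g : cmeasurable D f -> cmeasurable D g ->
  cmeasurable D (fun t => f t * g t).
Proof.
move=> [fr fi] [gr gi]; split.
- rewrite (_ : (fun t => _) = (fun t => complex.Re (f t) * complex.Re (g t) -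
    complex.Im (f t) * complex.Im (g t))).
    by apply: measurable_funB; exact: measurable_funM.
  by apply/funext => t; case: (f t) (g t) => ? ? [].
- rewrite (_ : (fun t => _) = (fun t => complex.Re (f t) * complex.Im (g t) +
    complex.Im (f t) * complex.Re (g t))).
    by apply: measurable_funD; exact: measurable_funM.
  by apply/funext => t; case: (f t) (g t) => ? ? [].
Qed.

Lemma cmeasurableB D f g : cmeasurable D f -> cmeasurable D g ->
  cmeasurable D (fun t => f t - g t).
Proof.
move=> mf mg; apply: eq_cmeasurable (_ : cmeasurable D (fun t => f t + (-1) * g t)).
  by move=> t _; rewrite mulN1r.
by apply: cmeasurableD => //; apply: cmeasurableM => //; exact: cmeasurable_cst.
Qed.

Lemma measurable_cabs D f : cmeasurable D f ->
  measurable_fun D (fun t => cabs (f t)).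
Proof.
move=> [fr fi].
rewrite (_ : (fun t => _) =
  (fun t => (complex.Re (f t) ^+ 2 + complex.Im (f t) ^+ 2) `^ 2^-1)).
  apply: (measurableT_comp (measurable_powR _)).
  by apply: measurable_funD; exact: measurable_funX.
by apply/funext => t; rewrite cabsE powR12_sqrt// addr_ge0 ?sqr_ge0.
Qed.

Lemma cmeasurableV D f : cmeasurable D f -> cmeasurable D (fun t => (f t)^-1).
Proof.
move=> mf; have mabs := measurable_cabs mf; case: mf => fr fi.
(* On nonnegative reals [powR] with exponent -1 agrees with inversion, including the value 0 at 0,
   so the formulas below also hold at zeros of [f]. *)
have mN : measurable_fun D (fun t => cabs (f t) `^ (-1) * cabs (f t) `^ (-1)).
  by apply: measurable_funM; apply: (measurableT_comp (measurable_powR _)).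
have E t : cabs (f t) `^ (-1) * cabs (f t) `^ (-1) =
    (complex.Re (f t) ^+ 2 + complex.Im (f t) ^+ 2)^-1.
  by rewrite powR_inv1 ?cabs_ge0// -invfM -expr2 cabs_sqr.
split.
- rewrite (_ : (fun t => _) = (fun t => complex.Re (f t) *
    (cabs (f t) `^ (-1) * cabs (f t) `^ (-1)))); first exact: measurable_funM.
  by apply/funext => t; rewrite E; case: (f t).
- rewrite (_ : (fun t => _) = (fun t => - complex.Im (f t) *
    (cabs (f t) `^ (-1) * cabs (f t) `^ (-1)))).
    by apply: measurable_funM => //; exact: measurable_funN.
  by apply/funext => t; rewrite E mulNr; case: (f t).
Qed.

Lemma cmeasurable_cexp D f : cmeasurable D f -> cmeasurable D (fun t => cexp (f t)).
Proof.
move=> [fr fi].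
have me : measurable_fun D (fun t => expR (complex.Re (f t))).
  exact: (measurableT_comp (@measurable_expR R)).
split.
- rewrite (_ : (fun t => _) =
    (fun t => expR (complex.Re (f t)) * cos (complex.Im (f t)))).
    apply: measurable_funM => //.
    apply: (measurableT_comp (continuous_measurable_fun (@continuous_cos R))) => //.
  by apply/funext => t; rewrite /cexp /= mul0r subr0.
- rewrite (_ : (fun t => _) =
    (fun t => expR (complex.Re (f t)) * sin (complex.Im (f t)))).
    apply: measurable_funM => //.
    apply: (measurableT_comp (continuous_measurable_fun (@continuous_sin R))) => //.
  by apply/funext => t; rewrite /cexp /= mul0r addr0.
Qed.

Lemma measurable_inv D (h : T -> R) : measurable_fun D h ->
  measurable_fun D (fun t => (h t)^-1).
Proof.
move=> mh; have [] := cmeasurableV (cmeasurable_real mh).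
move=> + _; apply: eq_measurable_fun => t _ /=.
rewrite expr0n addr0; have [->|h0] := eqVneq (h t) 0.
  by rewrite mul0r invr0.
by rewrite expr2 invfM mulrA divff// mul1r.
Qed.

Lemma cmeasurable_clog D f : cmeasurable D f -> cmeasurable D (fun t => clog (f t)).
Proof.
move=> mf; have mabs := measurable_cabs mf; case: mf => fr fi; split => /=.
  exact: (measurableT_comp (@measurable_ln R)).
apply: measurable_funB; first exact: measurable_cst.
apply: (measurableT_comp (continuous_measurable_fun (@continuous_atan R))) => //.
by apply: measurable_funM => //; exact: measurable_inv.
Qed.

Variable mu : {measure set T -> \bar R}.

Definition cintegrable D f :=
  mu.-integrable D (EFin \o (fun t => complex.Re (f t))) /\
  mu.-integrable D (EFin \o (fun t => complex.Im (f t))).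

Lemma cintegrable_le D f (h : T -> R) : measurable D -> cmeasurable D f ->
  mu.-integrable D (EFin \o h) -> (forall t, D t -> cabs (f t) <= h t) ->
  cintegrable D f.
Proof.
move=> mD [fr fi] ih fh; split.
- apply: (le_integrable mD _ _ ih); first exact/measurable_EFinP.
  move=> t Dt /=; rewrite lee_fin.
  by rewrite (le_trans (le_Re_cabs _))// (le_trans (fh _ Dt))// ler_norm.
- apply: (le_integrable mD _ _ ih); first exact/measurable_EFinP.
  move=> t Dt /=; rewrite lee_fin.
  by rewrite (le_trans (le_Im_cabs _))// (le_trans (fh _ Dt))// ler_norm.
Qed.

Lemma integrableZl_EFin D (h : T -> R) (r : R) : measurable D ->
  mu.-integrable D (EFin \o h) -> mu.-integrable D (EFin \o (fun t => r * h t)).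
Proof. by move=> mD ih; apply: eq_integrable (integrableZl mD r ih). Qed.

Lemma cintegralZl D f (c : R[i]) : measurable D -> cintegrable D f ->
  cintegral mu D (fun t => c * f t) = c * cintegral mu D f.
Proof.
move=> mD [fr fi]; rewrite /cintegral; case: c => x y; simpc.
congr (_ +i* _)%C.
- rewrite -!RintegralZl// -RintegralB//; try exact: integrableZl_EFin.
  by apply: eq_Rintegral => t _; case: (f t).
- rewrite -!RintegralZl// -RintegralD//; try exact: integrableZl_EFin.
  by apply: eq_Rintegral => t _; case: (f t).
Qed.

Lemma cintegralB D f g : measurable D -> cintegrable D f -> cintegrable D g ->
  cintegral mu D (fun t => f t - g t) = cintegral mu D f - cintegral mu D g.
Proof.
move=> mD [fr fi] [gr gi]; rewrite /cintegral; simpc.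
congr (_ +i* _)%C.
- rewrite -RintegralB//; apply: eq_Rintegral => t _.
  by case: (f t) (g t) => ? ? [].
- rewrite -RintegralB//; apply: eq_Rintegral => t _.
  by case: (f t) (g t) => ? ? [].
Qed.

Lemma eq_cintegral D f g : (forall t, D t -> f t = g t) ->
  cintegral mu D f = cintegral mu D g.
Proof.
move=> fg; rewrite /cintegral; congr (_ +i* _)%C;
by apply: eq_Rintegral => t /set_mem Dt; rewrite fg.
Qed.

Lemma cintegral_dominated_cvg0 D (f : nat -> T -> R[i]) (h : T -> R) :
  measurable D -> (forall n, cmeasurable D (f n)) ->
  mu.-integrable D (EFin \o h) -> (forall n t, D t -> cabs (f n t) <= h t) ->
  (forall t, D t -> cabs (f n t) @[n --> \oo] --> 0) ->
  cabs (cintegral mu D (f n)) @[n --> \oo] --> 0.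
Proof.
move=> mD mf ih fh f0.
have part (u : nat -> T -> R) : (forall n, measurable_fun D (u n)) ->
    (forall n t, `|u n t| <= cabs (f n t)) ->
    (\int[mu]_(t in D) (u n t))%R @[n --> \oo] --> (0 : R).
  move=> mu_ uf.
  have : (\int[mu]_(t in D) (u n t)%:E)%E @[n --> \oo] --> (\int[mu]_(t in D) 0)%E.
    have [] // := @dominated_convergence _ _ _ mu D mD
      (fun n t => (u n t)%:E) (cst 0%E) (EFin \o h).
    - by move=> n; exact/measurable_EFinP.
    - apply: aeW => t Dt; apply: cvg_EFin; first by near=> n.
      apply/norm_cvg0P; apply: (squeeze_cvgr _ (cvg_cst 0) (f0 t Dt)).
      by apply: nearW => n /=; rewrite normr_ge0 uf.
    - apply: aeW => t n Dt /=; rewrite lee_fin.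
      by rewrite (le_trans (uf _ _)) ?fh.
  rewrite integral0 => /fine_cvgP[_]; exact.
apply: (@squeeze_cvgr _ _ _ _ (cst 0)
  (fun n => `|\int[mu]_(t in D) complex.Re (f n t)| +
            `|\int[mu]_(t in D) complex.Im (f n t)|)%R).
- by apply: nearW => n; rewrite cabs_ge0 cabs_le_ReIm.
- exact: cvg_cst.
- rewrite -[X in _ --> X](addr0 0) -[X in _ --> X + _](normr0 R) -[X in _ --> _ + X](normr0 R).
  apply: cvgD; apply: cvg_norm; apply: part.
  + by move=> n; exact: (mf n).1.
  + by move=> n t; exact: le_Re_cabs.
  + by move=> n; exact: (mf n).2.
  + by move=> n t; exact: le_Im_cabs.
Unshelve. all: by end_near. Qed.

End ComplexIntegrals.
(* At [K = R[i]] the pointwise forms of the library lemmas fail to unify; over an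
   abstract [K] they do not. *)
Section OneVariable.
Variable K : numFieldType.
Implicit Types (f g : K^o -> K^o) (x c : K^o).

Lemma derivable_mul f g x : derivable f x 1 -> derivable g x 1 ->
  derivable (fun y => f y * g y : K^o) x 1.
Proof. exact: derivableM. Qed.

Lemma derivable_add f g x : derivable f x 1 -> derivable g x 1 ->
  derivable (fun y => f y + g y : K^o) x 1.
Proof. exact: derivableD. Qed.

Lemma derivable_sub f g x : derivable f x 1 -> derivable g x 1 ->
  derivable (fun y => f y - g y : K^o) x 1.
Proof. exact: derivableB. Qed.

Lemma derivable_comp f g x : derivable f x 1 -> derivable g (f x) 1 ->
  derivable (fun y => g (f y) : K^o) x 1.
Proof.
move=> /derivable1_diffP df /derivable1_diffP dg; apply/derivable1_diffP.
exact: differentiable_comp.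
Qed.

Lemma derivable_const c x : derivable (fun=> c : K^o) x 1.
Proof. exact: derivable_cst. Qed.

Lemma derivable_ident x : derivable (fun y => y : K^o) x 1.
Proof. exact: derivable_id. Qed.

End OneVariable.

(** * Test functions *)

Section TestFunctions.
Variable R : realType.
Implicit Types (z w : R[i]) (s xi eps t x y : R).

Lemma clog_arg z : 0 < complex.Im (clog z) < pi.
Proof.
rewrite /clog /=; have := atan_gtNpi2 (complex.Re z / complex.Im z).
by have := atan_ltpi2 (complex.Re z / complex.Im z); lra.
Qed.

Lemma cabs_cexp_clog s xi z : z != 0 ->
  cabs (cexp ((- s +i* xi)%C * clog z)) =
  cabs z `^ (- s) * expR (- (xi * complex.Im (clog z))).
Proof.
move=> z0; rewrite cabs_cexp /clog; simpc => /=.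
by rewrite expRD /powR gt_eqF ?cabs_gt0// mulNr.
Qed.

Lemma xi_arg_bound xi (th : R) : - pi <= th <= pi -> - (xi * th) <= `|xi| * pi.
Proof.
move=> /andP[h1 h2]; rewrite -mulrN (le_trans (ler_norm _))// normrM normrN.
by rewrite ler_wpM2l// ler_norml h1.
Qed.

(** Since the argument lies between 0 and pi, the factor e^(-xi arg z) is bounded above and below
    independently of z: up to constants, the modulus is |z|^(-s). *)
Lemma cabs_cexp_clog_le s xi z : z != 0 ->
  cabs (cexp ((- s +i* xi)%C * clog z)) <= expR (`|xi| * pi) * cabs z `^ (- s).
Proof.
move=> z0; rewrite cabs_cexp_clog// mulrC ler_wpM2r ?powR_ge0// ler_expR.
by apply: xi_arg_bound; have := clog_arg z; have := pi_ge0 R; lra.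
Qed.

Lemma cabs_cexp_clog_ge s xi z : z != 0 ->
  expR (- (`|xi| * pi)) * cabs z `^ (- s) <= cabs (cexp ((- s +i* xi)%C * clog z)).
Proof.
move=> z0; rewrite cabs_cexp_clog// mulrC ler_wpM2l ?powR_ge0// ler_expR.
rewrite lerN2 -[xi * _]opprK -mulNr -(normrN xi).
by apply: xi_arg_bound; have := clog_arg z; have := pi_ge0 R; lra.
Qed.

(** Its only zero is -i, below the half-plane; its reciprocal supplies one power of decay at
    infinity. *)
Definition pole z : R[i] := 1 - (0 +i* 1)%C * z.

Lemma poleE x y : pole (x +i* y)%C = ((1 + y) -i* x)%C.
Proof. by apply/eqP; rewrite eq_complex /=; apply/andP; split; apply/eqP; ring. Qed.

Lemma pole_ge1 z : 0 <= complex.Im z -> 1 <= cabs (pole z).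
Proof.
case: z => x y /= y0; rewrite poleE; apply: ler_sqrW; first exact: cabs_ge0.
by rewrite cabs_sqr /= !expr2; nra.
Qed.

Lemma pole_ge z : 0 <= complex.Im z -> cabs z <= cabs (pole z).
Proof.
case: z => x y /= y0; rewrite poleE; apply: ler_sqrW; first exact: cabs_ge0.
by rewrite !cabs_sqr /= !expr2; nra.
Qed.

Lemma pole_le z : cabs (pole z) <= 1 + cabs z.
Proof.
rewrite /pole (le_trans (cabsD _ _))// cabs1 cabsN cabsM.
by rewrite [cabs (Complex _ _)]cabsE /= expr0n expr1n add0r sqrtr1 mul1r.
Qed.

Lemma pole_neq0 z : 0 <= complex.Im z -> pole z != 0.
Proof. by move=> z0; rewrite -cabs_gt0 (lt_le_trans ltr01)// pole_ge1. Qed.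

(* [z ^ (- s + i xi)], regularised near 0 at the scale [eps] and damped at
   infinity by the factor [1 / pole]. *)
Definition testfun s xi eps z : R[i] :=
  cexp ((- s +i* xi)%C * clog (z + (0 +i* eps)%C)) / pole z.

Lemma holomorphic_testfun s xi eps (k : R[i]) : 0 < eps ->
  holomorphic_on upper_half_plane (fun z => k * testfun s xi eps z).
Proof.
move=> eps0 z z0; have z1 : 0 < complex.Im (z + (0 +i* eps)%C).
  by move: z0; rewrite /upper_half_plane /=; case: (z) => x y /= y0; rewrite addr_gt0.
apply: (@derivable_mul R[i]); first exact: (@derivable_const R[i]).
apply: (@derivable_mul R[i]).
  apply: (@derivable_comp R[i] _ cexp); last exact: derivable_cexp.
  apply: (@derivable_mul R[i]); first exact: (@derivable_const R[i]).
  apply: (@derivable_comp R[i] _ (@clog R)); last exact: derivable_clog.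
  apply: (@derivable_add R[i]); first exact: (@derivable_ident R[i]).
  exact: (@derivable_const R[i]).
have p0 : pole z != 0 by rewrite pole_neq0// ltW.
have dpole : derivable (pole : R[i]^o -> R[i]^o) z 1.
  apply: (@derivable_sub R[i]); first exact: (@derivable_const R[i]).
  apply: (@derivable_mul R[i]); first exact: (@derivable_const R[i]).
  exact: (@derivable_ident R[i]).
exact: (@derivableV R[i] R[i]^o pole z 1 p0 dpole).
Qed.

Lemma cabs_shift_ge z eps : 0 <= complex.Im z -> 0 <= eps ->
  cabs z <= cabs (z + (0 +i* eps)%C) /\ eps <= cabs (z + (0 +i* eps)%C).
Proof.
case: z => x y /= y0 eps0; split; apply: ler_sqrW; rewrite ?cabs_ge0//.
  by rewrite !cabs_sqr /= !expr2; nra.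
by rewrite cabs_sqr /= !expr2; nra.
Qed.

Lemma cabs_shift_le z eps : 0 <= eps -> cabs (z + (0 +i* eps)%C) <= cabs z + eps.
Proof.
move=> e0; rewrite (le_trans (cabsD _ _))// lerD2l cabsE /= expr0n add0r.
by rewrite sqrtr_sqr ger0_norm.
Qed.

Lemma Im_shift_gt0 z eps : 0 < complex.Im z -> 0 <= eps ->
  0 < complex.Im (z + (0 +i* eps)%C).
Proof. by case: z => x y /= y0 e0; rewrite ltr_wpDr. Qed.

Lemma testfun_le s xi eps z : 0 < complex.Im z -> 0 <= eps ->
  cabs (testfun s xi eps z) <=
  expR (`|xi| * pi) * cabs (z + (0 +i* eps)%C) `^ (- s) / cabs (pole z).
Proof.
move=> z0 e0; rewrite /testfun cabsM cabsV ler_wpM2r ?invr_ge0 ?cabs_ge0//.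
by apply/cabs_cexp_clog_le/upper_neq0/Im_shift_gt0.
Qed.

Lemma testfun_ge s xi eps z : 0 < complex.Im z -> 0 <= eps ->
  expR (- (`|xi| * pi)) * cabs (z + (0 +i* eps)%C) `^ (- s) / cabs (pole z) <=
  cabs (testfun s xi eps z).
Proof.
move=> z0 e0; rewrite /testfun cabsM cabsV ler_wpM2r ?invr_ge0 ?cabs_ge0//.
by apply/cabs_cexp_clog_ge/upper_neq0/Im_shift_gt0.
Qed.

(* The defect of [testfun] from being an eigenfunction of [f |-> f (. / t)]. *)
Definition dilation_ratio s xi eps z t : R[i] :=
  cexp ((- s +i* xi)%C *
    (clog (z + (0 +i* (eps * t))%C) - clog (z + (0 +i* eps)%C))) *
  (pole z / pole (z / t%:C%C)).

Lemma complex_divr x y t : t != 0 -> ((x +i* y)%C / t%:C%C) = (x / t +i* (y / t))%C.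
Proof. by move=> t0; rewrite -fmorphV /=; simpc. Qed.

Lemma Re_divr z t : t != 0 -> complex.Re (z / t%:C%C) = complex.Re z / t.
Proof. by case: z => x y t0; rewrite complex_divr. Qed.

Lemma Im_divr z t : t != 0 -> complex.Im (z / t%:C%C) = complex.Im z / t.
Proof. by case: z => x y t0; rewrite complex_divr. Qed.

Lemma clog_div z t : 0 < t -> 0 < complex.Im z -> clog (z / t%:C%C) = clog z - (ln t)%:C%C.
Proof.
move=> t0 z0; rewrite /clog cabsM cabsV cabs_real gtr0_norm//.
rewrite ln_div ?posrE ?cabs_gt0 ?upper_neq0//; simpc.
rewrite Re_divr ?Im_divr ?gt_eqF//; congr (_ +i* (_ - atan _))%C; field.
by rewrite !gt_eqF.
Qed.

(** Dilation rescales the regularisation: z/t + i eps = (z + i eps t)/t. Dividing by t subtracts ln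
    t from [clog], which produces the power t^(s - i xi); the change from eps to eps t is left to
    [dilation_ratio]. *)
Lemma testfun_dilation s xi eps z t : 0 < t -> 0 < complex.Im z -> 0 <= eps ->
  testfun s xi eps (z / t%:C%C) =
  testfun s xi eps z * cexp ((s -i* xi)%C * (ln t)%:C%C) * dilation_ratio s xi eps z t.
Proof.
move=> t0 z0 e0; rewrite /testfun /dilation_ratio.
have tn0 : t%:C%C != 0 :> R[i] by rewrite eq_complex /= gt_eqF.
have -> : z / t%:C%C + (0 +i* eps)%C = (z + (0 +i* (eps * t))%C) / t%:C%C.
  rewrite mulrDl; congr (_ + _); rewrite complex_divr ?gt_eqF// mul0r mulfK ?gt_eqF//.
rewrite clog_div ?Im_shift_gt0 ?mulr_ge0 ?(ltW t0)//.
rewrite !mulrBr !cexpB.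
have -> : (s -i* xi)%C = - (- s +i* xi)%C by simpc.
rewrite mulNr cexpN.
have p1 : pole z != 0 by rewrite pole_neq0// ltW.
have p2 : pole (z / t%:C%C) != 0.
  by rewrite pole_neq0// Im_divr ?gt_eqF// divr_ge0// ltW.
by field; rewrite p1 p2 !cexp_neq0.
Qed.

End TestFunctions.

(** * Bounds on the dilation defect *)

Section Dilation.
Variable R : realType.
Implicit Types (z w c : R[i]) (s xi eps t r : R).

Lemma cabs_cexpB1_le z : cabs z <= 2^-1 -> cabs (cexp z - 1) <= 6 * cabs z.
Proof.
move=> z1; have := cexp_quadratic z1.
move=> h; rewrite -[X in cabs X](subrK z) (le_trans (cabsD _ _))//.
by have := cabs_ge0 z; move: h; rewrite expr2; nra.
Qed.

(** The bound is free of t, as domination requires. It combines |z + i eps| <= 2|z| <= 2|z + i eps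
    t|, two arguments differing by at most pi, and |pole z| <= 2 against |pole (z/t)| >= 1. *)
Lemma cabs_dilation_ratio_le s xi eps z t : 0 < s -> 0 < eps -> 0 < complex.Im z ->
  0 < t -> eps <= cabs z -> cabs z <= 1 ->
  cabs (dilation_ratio s xi eps z t) <= expR (s * ln 2) * expR (`|xi| * pi) * 2.
Proof.
move=> s0 e0 z0 t0 ez z1; rewrite /dilation_ratio cabsM.
have zn : z != 0 by exact: upper_neq0.
apply: ler_pM; rewrite ?cabs_ge0//.
  rewrite cabs_cexp -expRD ler_expR.
  set w1 := z + _; set w2 := z + (0 +i* eps)%C.
  have /andP[a1 a1'] := clog_arg w1; have /andP[a2 a2'] := clog_arg w2.
  have -> : complex.Re ((- s +i* xi)%C * (clog w1 - clog w2)) =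
     s * (ln (cabs w2) - ln (cabs w1)) +
     - (xi * (complex.Im (clog w1) - complex.Im (clog w2))).
    by rewrite /clog; simpc => /=; ring.
  rewrite lerD//; last by apply: xi_arg_bound; lra.
  rewrite ler_wpM2l ?(ltW s0)//.
  have w10 : 0 < cabs w1.
    by rewrite cabs_gt0 upper_neq0// Im_shift_gt0// mulr_ge0// ltW.
  have w20 : 0 < cabs w2 by rewrite cabs_gt0 upper_neq0// Im_shift_gt0// ltW.
  rewrite -ln_div ?posrE// ler_ln ?posrE ?divr_gt0// ler_pdivrMr//.
  have [h1 _] := @cabs_shift_ge R z (eps * t) (ltW z0) (mulr_ge0 (ltW e0) (ltW t0)).
  have := @cabs_shift_le R z eps (ltW e0).
  by move: h1; rewrite -/w1 -/w2; lra.
rewrite cabsM cabsV ler_pdivrMr; last first.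
  by rewrite cabs_gt0 pole_neq0// Im_divr ?gt_eqF// divr_ge0 ?ltW.
have := @pole_ge1 R (z / t%:C%C); rewrite Im_divr ?gt_eqF// => /(_ (divr_ge0 (ltW z0) (ltW t0))).
by have := pole_le z; lra.
Qed.

(** The two points differ by i eps (t - 1), and the vertical segment joining them lies above z,
    hence at modulus at least |z|. The factor 2 comes from adding the real and imaginary parts. *)
Lemma cabs_clog_shift_le eps z t r : 0 < eps -> 0 < complex.Im z -> 0 < t ->
  eps <= r * cabs z ->
  cabs (clog (z + (0 +i* (eps * t))%C) - clog (z + (0 +i* eps)%C)) <=
  2 * `|t - 1| * r.
Proof.
move=> e0 z0 t0 ez.
have zc : 0 < cabs z by rewrite cabs_gt0 upper_neq0.
have et0 : 0 <= eps * t by rewrite mulr_ge0// ltW.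
have E : z + (0 +i* (eps * t))%C - (z + (0 +i* eps)%C) = (0 +i* (eps * (t - 1)))%C.
  by apply/eqP; rewrite eq_complex; case: (z) => x y /=; apply/andP; split; apply/eqP; ring.
have [] := @clog_lipschitz R (z + (0 +i* eps)%C) (z + (0 +i* (eps * t))%C) (cabs z) zc
   (Im_shift_gt0 z0 (ltW e0)) (Im_shift_gt0 z0 et0).
  move=> u /andP[u0 u1]; rewrite E.
  have -> : z + (0 +i* eps)%C + u%:C%C * (0 +i* (eps * (t - 1)))%C =
      z + (0 +i* (eps * (1 - u + u * t)))%C.
    by apply/eqP; rewrite eq_complex; case: (z) => x y /=; apply/andP; split; apply/eqP; ring.
  apply: (cabs_shift_ge (ltW z0) _).1.
  by rewrite mulr_ge0 ?(ltW e0)// addr_ge0 ?subr_ge0// mulr_ge0// ltW.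
have le : cabs (0 +i* (eps * (t - 1)))%C / cabs z <= `|t - 1| * r.
  rewrite cabsE /= expr0n add0r sqrtr_sqr normrM (gtr0_norm e0) ler_pdivrMr//.
  by rewrite mulrC -mulrA ler_wpM2l.
rewrite E => h1 h2; rewrite (le_trans (cabs_le_ReIm _))//.
by move: h1 h2 le; lra.
Qed.

(** Gives the pointwise limit for fixed t. The rate degenerates as t tends to 0 or to infinity, and
    the two smallness conditions on r depend on t. *)
Lemma dilation_ratio_close s xi eps z t r : 0 < eps -> 0 < complex.Im z -> 0 < t ->
  eps <= r * cabs z -> cabs z <= r -> r <= 1 ->
  cabs (- s +i* xi)%C * (2 * `|t - 1| * r) <= 2^-1 ->
  `|t^-1 - 1| * r <= 1 ->
  cabs (dilation_ratio s xi eps z t - 1) <=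
  (24 * cabs (- s +i* xi)%C * `|t - 1| + `|t^-1 - 1|) * r.
Proof.
move=> e0 z0 t0 ez zr r1 small small'.
have tz0 : 0 <= complex.Im (z / t%:C%C).
  by rewrite Im_divr ?gt_eqF// divr_ge0 ?ltW.
rewrite /dilation_ratio.
set c := (- s +i* xi)%C in small *; set dl := clog _ - clog _.
set q := pole z / _.
have dle : cabs (c * dl) <= cabs c * (2 * `|t - 1| * r).
  by rewrite cabsM ler_wpM2l ?cabs_ge0// cabs_clog_shift_le.
have eb := @cabs_cexpB1_le (c * dl) (le_trans dle small).
have qb : cabs (q - 1) <= `|t^-1 - 1| * r.
  have pn := pole_neq0 tz0.
  have -> : q - 1 = (0 +i* 1)%C * z * (t^-1 - 1)%:C%C / pole (z / t%:C%C).
    rewrite /q -[X in _ - X](divff pn) -mulrBl; congr (_ / _).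
    by rewrite /pole rmorphB rmorph1 fmorphV; ring.
  rewrite !cabsM cabsV cabs_real [cabs (0 +i* 1)%C]cabsE /= expr0n expr1n add0r sqrtr1 mul1r.
  rewrite ler_pdivrMr ?(lt_le_trans ltr01 (pole_ge1 tz0))//.
  rewrite mulrC -mulrA ler_wpM2l// (le_trans zr)//.
  by rewrite ler_peMr ?pole_ge1// (le_trans _ zr) ?cabs_ge0.
have q2 : cabs q <= 2.
  have -> : q = (q - 1) + 1 by ring.
  by rewrite (le_trans (cabsD _ _))// cabs1; move: qb small'; lra.
have -> : cexp (c * dl) * q - 1 = (cexp (c * dl) - 1) * q + (q - 1) by ring.
rewrite (le_trans (cabsD _ _))// [leRHS]mulrDl; apply: lerD => //.
rewrite cabsM.
(* The constant 24 collects 6 from [cabs_cexpB1_le], 2 from the shift of [clog] and 2 from |q| <=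
   2. *)
have -> : 24 * cabs c * `|t - 1| * r = 6 * (cabs c * (2 * `|t - 1| * r)) * 2 by ring.
by apply: ler_pM; rewrite ?cabs_ge0// (le_trans eb)// ler_wpM2l.
Qed.

End Dilation.

(* In the application [tau] is the identity; keeping it abstract separates the
   completed sigma-algebra on the domain of [phi] from the Borel sets of [R]. *)
Section MellinKernel.
Context {d : measure_display} {T : measurableType d} {R : realType}.
Variables (mu : {measure set T -> \bar R}) (D : set T) (tau : T -> R).
Variables (s xi : R) (phi : T -> R[i]).
Implicit Types (z : R[i]) (eps : R) (t : T).

Hypothesis measurable_D : measurable D.
Hypothesis mtau : measurable_fun D tau.
Hypothesis tau_gt0 : forall t, D t -> 0 < tau t.
Hypothesis s0 : 0 < s.
Hypothesis mphi : cmeasurable D phi.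
Hypothesis iphi : (\int[mu]_(t in D) (cabs (phi t) * tau t `^ (s - 1))%:E < +oo)%E.

Definition mellin_kernel t : R[i] :=
  (phi t * (tau t `^ s)%:C / cpow (tau t) (1 +i* xi))%C.

Lemma cmeasurable_mellin_kernel : cmeasurable D mellin_kernel.
Proof.
apply: cmeasurableM.
  apply: cmeasurableM => //; apply: cmeasurable_real.
  exact: (measurableT_comp (measurable_powR s)).
apply/cmeasurableV/cmeasurable_cexp/cmeasurableM; first exact: cmeasurable_cst.
by apply: cmeasurable_real; apply: (measurableT_comp (@measurable_ln R)).
Qed.

Lemma cmeasurable_dilation_ratio eps z :
  cmeasurable D (fun t => dilation_ratio s xi eps z (tau t)).
Proof.
have mt := cmeasurable_real mtau.
apply: cmeasurableM.
  apply: cmeasurable_cexp; apply: cmeasurableM; first exact: cmeasurable_cst.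
  apply: cmeasurableB; last exact: cmeasurable_cst.
  apply: cmeasurable_clog; apply: cmeasurableD; first exact: cmeasurable_cst.
  split; first exact: measurable_cst.
  by apply: measurable_funM => //; exact: measurable_cst.
apply: cmeasurableM; first exact: cmeasurable_cst.
apply: cmeasurableV; apply: cmeasurableB; first exact: cmeasurable_cst.
apply: cmeasurableM; first exact: cmeasurable_cst.
by apply: cmeasurableM; [exact: cmeasurable_cst|exact: cmeasurableV].
Qed.

Lemma cabs_mellin_kernel t : D t ->
  cabs (mellin_kernel t) = cabs (phi t) * tau t `^ (s - 1).
Proof.
move=> /tau_gt0 t0; rewrite /mellin_kernel !cabsM cabsV cabs_real ger0_norm ?powR_ge0//.
rewrite cabs_cexp powRB ?(gt_eqF t0) ?implybT// powRr1 ?ltW// -mulrA; congr (_ * (_ / _)).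
by simpc => /=; rewrite lnK ?posrE.
Qed.

Lemma integrable_mellin_majorant :
  mu.-integrable D (EFin \o (fun t => cabs (phi t) * tau t `^ (s - 1))).
Proof.
apply/integrableP; split.
  apply/measurable_EFinP; apply: measurable_funM; first exact: measurable_cabs.
  exact: (measurableT_comp (measurable_powR (s - 1))).
apply: le_lt_trans iphi; rewrite le_eqVlt; apply/orP; left; apply/eqP.
by apply: eq_integral => t _ /=; rewrite ger0_norm// mulr_ge0 ?cabs_ge0 ?powR_ge0.
Qed.

Lemma cintegrable_mellin_mul (g : T -> R[i]) (C : R) :
  cmeasurable D g -> 0 <= C ->
  (forall t, D t -> cabs (g t) <= C) ->
  cintegrable mu D (fun t => mellin_kernel t * g t).
Proof.
move=> mg C0 gC.
apply: (@cintegrable_le _ _ _ mu D _ (fun t => C * (cabs (phi t) * tau t `^ (s - 1)))).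
- exact: measurable_D.
- by apply: cmeasurableM => //; exact: cmeasurable_mellin_kernel.
- exact: (integrableZl_EFin C measurable_D integrable_mellin_majorant).
- move=> t Dt.
  by rewrite cabsM cabs_mellin_kernel// mulrC ler_wpM2r ?gC// mulr_ge0 ?cabs_ge0 ?powR_ge0.
Qed.

Lemma cintegrable_mellin_kernel : cintegrable mu D mellin_kernel.
Proof.
have := @cintegrable_mellin_mul (fun=> 1) 1 (cmeasurable_cst _ _) ler01.
rewrite (_ : (fun t => mellin_kernel t * 1) = mellin_kernel); last first.
  by apply/funext => t; rewrite mulr1.
by apply=> t _; rewrite cabs1.
Qed.

(** Since t^(s - i xi)/t = t^s/t^(1 + i xi), the integrand on the left is the test function at z
    times the Mellin kernel times the dilation ratio; subtracting the eigenvalue term replaces the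
    ratio by its distance from 1. *)
Lemma dilation_average_testfun eps (k z : R[i]) : 0 < eps -> 0 < complex.Im z ->
  eps <= cabs z -> cabs z <= 1 ->
  cintegral mu D (fun t => k * testfun s xi eps (z / (tau t)%:C%C) * (phi t / (tau t)%:C%C)) -
    cintegral mu D mellin_kernel * (k * testfun s xi eps z) =
  k * testfun s xi eps z *
  cintegral mu D (fun t => mellin_kernel t * (dilation_ratio s xi eps z (tau t) - 1)).
Proof.
move=> e0 z0 ez z1.
have I1 : cintegrable mu D (fun t => mellin_kernel t * dilation_ratio s xi eps z (tau t)).
  apply: (cintegrable_mellin_mul (C := expR (s * ln 2) * expR (`|xi| * pi) * 2)).
  - exact: cmeasurable_dilation_ratio.
  - by rewrite !mulr_ge0 ?expR_ge0.
  - by move=> t /tau_gt0 t0; exact: cabs_dilation_ratio_le.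
have I2 := cintegrable_mellin_kernel.
rewrite [cintegral _ _ _ * _]mulrC.
have -> : cintegral mu D (fun t => mellin_kernel t * (dilation_ratio s xi eps z (tau t) - 1)) =
   cintegral mu D (fun t => mellin_kernel t * dilation_ratio s xi eps z (tau t)) -
   cintegral mu D mellin_kernel.
  rewrite -cintegralB//.
  by apply: eq_cintegral => t _; rewrite mulrBr mulr1.
rewrite mulrBr; congr (_ - _).
rewrite -cintegralZl//.
apply: eq_cintegral => t Dt; have t0 := tau_gt0 Dt.
rewrite testfun_dilation// ?(ltW e0)// /mellin_kernel /cpow.
(* All powers of [tau t] are written as values of [cexp], so that the identity becomes one between
   nonzero field elements. *)
have -> : (tau t)%:C%C = cexp (ln (tau t))%:C%C.
  by rewrite /cexp /= lnK ?posrE// cos0 sin0; simpc.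
have -> : (tau t `^ s)%:C%C = cexp (s * ln (tau t))%:C%C.
  by rewrite /cexp /= cos0 sin0 /powR gt_eqF//; simpc.
have -> : (1 +i* xi)%C * (ln (tau t))%:C%C =
  (s * ln (tau t))%:C%C - ((s -i* xi)%C * (ln (tau t))%:C%C) + (ln (tau t))%:C%C.
  by simpc; congr (_ +i* _)%C; ring.
rewrite cexpD cexpB.
by field; rewrite !cexp_neq0.
Qed.

(* Otherwise some sequence [eps_n], [z_n] with [eps_n / |z_n|] and [|z_n|] tending
   to 0 contradicts dominated convergence. *)
Lemma cintegral_dilation_small (eta : R) : 0 < eta ->
  exists2 r, 0 < r <= 1 & forall eps z, 0 < eps -> 0 < complex.Im z ->
    eps <= r * cabs z -> cabs z <= r ->
    cabs (cintegral mu D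
      (fun t => mellin_kernel t * (dilation_ratio s xi eps z (tau t) - 1))) <= eta.
Proof.
move=> eta0; apply: contrapT => H.
have {}H n : exists ez : R * R[i], [/\ 0 < ez.1, 0 < complex.Im ez.2,
    ez.1 <= n.+1%:R^-1 * cabs ez.2, cabs ez.2 <= n.+1%:R^-1 &
    eta < cabs (cintegral mu D
      (fun t => mellin_kernel t * (dilation_ratio s xi ez.1 ez.2 (tau t) - 1)))].
  apply: contrapT => H2; apply: H; exists n.+1%:R^-1; first by rewrite invr_gt0 ltr0n/= invf_le1// ler1n.
  move=> eps z e0 z0 ez zr; rewrite leNgt; apply/negP => bad.
  by apply: H2; exists (eps, z).
have {H} [u Hu] := choice H.
have rn (n : nat) : 0 < (n.+1%:R^-1 : R) <= 1.
  by rewrite invr_gt0 ltr0n/= invf_le1// ler1n.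
(* The uniform bound on the ratio, plus 1 for the subtracted 1. *)
pose B := expR (s * ln 2) * expR (`|xi| * pi) * 2 + 1.
have eu n : (u n).1 <= cabs (u n).2.
  have [_ _ h _ _] := Hu n; rewrite (le_trans h)// ler_piMl ?cabs_ge0//.
  by case/andP: (rn n).
have zu n : cabs (u n).2 <= 1.
  by have [_ _ _ h _] := Hu n; rewrite (le_trans h)//; by case/andP: (rn n).
have : cabs (cintegral mu D (fun t => mellin_kernel t *
    (dilation_ratio s xi (u n).1 (u n).2 (tau t) - 1))) @[n --> \oo] --> 0.
  apply: (@cintegral_dominated_cvg0 _ _ _ mu D
    (fun n t => mellin_kernel t * (dilation_ratio s xi (u n).1 (u n).2 (tau t) - 1))
    (fun t => B * (cabs (phi t) * tau t `^ (s - 1)))).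
  - exact: measurable_D.
  - move=> n; apply: cmeasurableM; first exact: cmeasurable_mellin_kernel.
    by apply: cmeasurableB; [exact: cmeasurable_dilation_ratio|exact: cmeasurable_cst].
  - exact: (integrableZl_EFin B measurable_D integrable_mellin_majorant).
  - move=> n t Dt; have t0 := tau_gt0 Dt.
    rewrite cabsM cabs_mellin_kernel// mulrC ler_wpM2r//.
      by rewrite mulr_ge0 ?cabs_ge0 ?powR_ge0.
    rewrite (le_trans (cabsD _ _))// cabsN cabs1 lerD2r.
    by have [? ? _ _ _] := Hu n; exact: cabs_dilation_ratio_le.
  - move=> t Dt; have t0 := tau_gt0 Dt.
    pose L := cabs (phi t) * tau t `^ (s - 1) *
      (24 * cabs (- s +i* xi)%C * `|tau t - 1| + `|(tau t)^-1 - 1|).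
    have cL (M : R) : M * n.+1%:R^-1 @[n --> \oo] --> 0.
      rewrite -(mulr0 M); apply: cvgM; first exact: cvg_cst.
      exact: cvg_harmonic.
    apply: (@squeeze_cvgr _ _ _ _ (cst 0) (fun n => L * n.+1%:R^-1)); last 2 first.
    + exact: cvg_cst.
    + exact: cL.
    near=> n; rewrite cabs_ge0 /= cabsM cabs_mellin_kernel// /L -[leRHS]mulrA ler_wpM2l//.
      by rewrite mulr_ge0 ?cabs_ge0 ?powR_ge0.
    have [? ? ? ? _] := Hu n.
    apply: dilation_ratio_close => //.
    + by case/andP: (rn n).
    + rewrite mulrA; near: n.
      apply: (cvgr_le _ (cL _)); lra.
    + by near: n; apply: (cvgr_le _ (cL _)); lra.
move=> /cvgr_lt /(_ eta eta0) [N _ /(_ N (leqnn N))] /=.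
by have [_ _ _ _ h] := Hu N; move=> /(lt_trans h); rewrite ltxx.
Unshelve. all: by end_near. Qed.

Lemma dilation_average_testfun_close (eta : R) : 0 < eta ->
  exists2 r, 0 < r <= 1 & forall eps k z, 0 < eps -> 0 < complex.Im z ->
    eps <= r * cabs z -> cabs z <= r ->
    (cabs (cintegral mu D mellin_kernel) - eta) * cabs (k * testfun s xi eps z) <=
    cabs (cintegral mu D (fun t => k * testfun s xi eps (z / (tau t)%:C%C) * (phi t / (tau t)%:C%C))).
Proof.
move=> /cintegral_dilation_small[r /andP[r0 r1] Hr].
exists r; first by rewrite r0.
move=> eps k z e0 z0 ez zr.
have z1 : cabs z <= 1 by exact: le_trans zr r1.
have ez' : eps <= cabs z by rewrite (le_trans ez)// ler_piMl ?cabs_ge0.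
have := dilation_average_testfun k e0 z0 ez' z1.
set H := cintegral _ _ _; set K := cintegral _ _ _; set F := k * _ => E.
have : cabs (H - K * F) <= cabs F * eta.
  by rewrite E cabsM ler_wpM2l ?cabs_ge0// Hr.
have : cabs (K * F) <= cabs H + cabs (H - K * F).
  by rewrite -(cabsBC (K * F)) -{1}[K * F](subrK H) addrC cabsD.
by rewrite cabsM; lra.
Qed.

End MellinKernel.
(** * Norms of the test functions *)

Section Mass.
Variables (R : realType) (p a xi : R).
Hypothesis p1 : 1 <= p.
Hypothesis a1 : -1 < a.
Implicit Types (eps x y r m : R).
Local Notation leb := (@lebesgue_measure R).
Local Notation s := ((a + 1) / p).
Local Notation B := (expR (`|xi| * pi)).

Let p0 : 0 < p. Proof. exact: lt_le_trans p1. Qed.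
Let a10 : 0 < a + 1. Proof. by rewrite -ltrBlDr sub0r. Qed.

Definition density eps y x : R :=
  cabs (testfun s xi eps (x +i* y)%C) `^ p * `|x| `^ a.

Definition near_weight r x : R := if `|x| <= r then `|x| `^ a else 0.

Definition far_weight x : R := if 1 < `|x| then `|x| `^ (- 1 - p) else 0.

Lemma density_ge0 eps y x : 0 <= density eps y x.
Proof. by rewrite mulr_ge0 ?powR_ge0. Qed.

Lemma near_weight_ge0 r x : 0 <= near_weight r x.
Proof. by rewrite /near_weight; case: ifP => // _; rewrite powR_ge0. Qed.

Lemma far_weight_ge0 x : 0 <= far_weight x.
Proof. by rewrite /far_weight; case: ifP => // _; rewrite powR_ge0. Qed.

Lemma le_powRN (u v b : R) : 0 < u -> u <= v -> 0 <= b -> v `^ (- b) <= u `^ (- b).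
Proof.
move=> u0 uv b0; have v0 := lt_le_trans u0 uv.
rewrite !powRN lef_pV2 ?posrE ?powR_gt0//.
by apply: ge0_ler_powR => //; rewrite nnegrE ltW.
Qed.

Lemma density_le eps y x : 0 < y -> 0 < eps ->
  density eps y x <=
  B `^ p * (cabs ((x +i* y)%C + (0 +i* eps)%C) `^ (- (a + 1)) *
            cabs (pole (x +i* y)%C) `^ (- p)) * `|x| `^ a.
Proof.
move=> y0 e0; rewrite /density ler_wpM2r ?powR_ge0//.
have := @testfun_le R s xi eps (x +i* y)%C y0 (ltW e0).
set W := cabs (_ + _); set P := cabs (pole _); set F := cabs _ => h.
have -> : B `^ p * (W `^ (- (a + 1)) * P `^ (- p)) = (B * W `^ (- s) / P) `^ p.
  rewrite -mulrA !powRM ?mulr_ge0 ?expR_ge0 ?powR_ge0 ?invr_ge0 ?cabs_ge0//.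
  rewrite -powRrM mulNr divfK ?gt_eqF//; congr (_ * (_ * _)).
  by rewrite -powR_inv1 ?cabs_ge0// -powRrM mulN1r.
apply: ge0_ler_powR => //; first exact: ltW.
  by rewrite nnegrE cabs_ge0.
by rewrite nnegrE !mulr_ge0 ?expR_ge0 ?powR_ge0 ?invr_ge0 ?cabs_ge0.
Qed.

Lemma density_le_near eps y x m : 0 < y -> 0 < eps -> 0 < m ->
  m <= cabs ((x +i* y)%C + (0 +i* eps)%C) ->
  density eps y x <= B `^ p * (m `^ (- (a + 1)) * `|x| `^ a).
Proof.
move=> y0 e0 m0 mW; rewrite (le_trans (density_le _ _ _))// -mulrA.
rewrite ler_wpM2l ?powR_ge0// ler_wpM2r ?powR_ge0// -[leRHS]mulr1.
apply: ler_pM; rewrite ?powR_ge0//; first by apply: le_powRN => //; exact: ltW.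
have h : 1 <= cabs (pole (x +i* y)%C) by apply: pole_ge1; exact: ltW.
rewrite (le_trans (le_powRN ltr01 h (ltW p0)))//.
by rewrite powR1.
Qed.

(** Both |z + i eps| and |pole z| are at least |x|, and the exponents -(a + 1), -p and a add up to
    -1 - p. *)
Lemma density_le_far eps y x : 0 < y -> 0 < eps -> 0 < `|x| ->
  density eps y x <= B `^ p * `|x| `^ (- 1 - p).
Proof.
move=> y0 e0 x0; rewrite (le_trans (density_le _ _ _))// -mulrA.
have xz : `|x| <= cabs (x +i* y)%C by exact: (le_Re_cabs (x +i* y)%C).
have y0' : 0 <= complex.Im (x +i* y)%C by exact: ltW.
rewrite ler_wpM2l ?powR_ge0//.
have -> : `|x| `^ (- 1 - p) = `|x| `^ (- (a + 1)) * `|x| `^ (- p) * `|x| `^ a.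
  by rewrite -!powRD ?(gt_eqF x0) ?implybT//; congr (_ `^ _); ring.
rewrite ler_wpM2r ?powR_ge0//.
apply: ler_pM; rewrite ?powR_ge0//; apply: le_powRN => //; try exact: ltW.
  by rewrite (le_trans xz)//; exact: (cabs_shift_ge y0' (ltW e0)).1.
by rewrite (le_trans xz)// pole_ge.
Qed.

Lemma density_le_weights eps y x : 0 < y -> 0 < eps ->
  density eps y x <= B `^ p * (eps `^ (- (a + 1)) * near_weight 1 x + far_weight x).
Proof.
move=> y0 e0; rewrite /near_weight /far_weight; case: leP => x1.
  rewrite addr0; apply: density_le_near => //.
  by apply: (cabs_shift_ge _ _).2; exact: ltW.
by rewrite mulr0 add0r density_le_far// (lt_trans ltr01).
Qed.

(* Where [testfun] is nearly an eigenfunction: [eps / r <= |z| <= r]. *)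
Definition region eps r y x : bool :=
  (eps <= r * cabs (x +i* y)%C) && (cabs (x +i* y)%C <= r).

(** One summand for each way out: |z| < eps/r, where |z + i eps| >= eps; |z| > r, where |z + i eps|
    >= r; and |x| > 1, treated separately because |x|^a need not be integrable at infinity. *)
Lemma density_outside_region eps r y x : 0 < y -> 0 < eps -> 0 < r ->
  ~~ region eps r y x ->
  density eps y x <= B `^ p * (eps `^ (- (a + 1)) * near_weight (eps / r) x +
    r `^ (- (a + 1)) * near_weight 1 x + far_weight x).
Proof.
move=> y0 e0 r0; rewrite /region negb_and -!ltNge => out.
have xz : `|x| <= cabs (x +i* y)%C by exact: (le_Re_cabs (x +i* y)%C).
have y0' : 0 <= complex.Im (x +i* y)%C by exact: ltW.
have [h1 h2] := cabs_shift_ge y0' (ltW e0).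
have [x1|x1] := leP `|x| 1; last first.
  rewrite (le_trans (density_le_far _ _ _))// ?(lt_trans ltr01)//.
  rewrite ler_wpM2l ?powR_ge0// /far_weight x1 lerDr.
  by rewrite addr_ge0// mulr_ge0 ?powR_ge0 ?near_weight_ge0.
case/orP: out => h.
  have xr : `|x| <= eps / r.
    rewrite ler_pdivlMr// mulrC (le_trans _ (ltW h))//.
    by apply: ler_wpM2l => //; exact: ltW.
  rewrite (le_trans (density_le_near _ _ e0 h2))// ler_wpM2l ?powR_ge0//.
  rewrite [near_weight (eps / r) x]/near_weight xr.
  by rewrite -addrA lerDl addr_ge0// ?far_weight_ge0// mulr_ge0 ?powR_ge0 ?near_weight_ge0.
rewrite (le_trans (density_le_near _ _ r0 (le_trans (ltW h) h1)))// ler_wpM2l ?powR_ge0//.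
rewrite [near_weight 1 x]/near_weight x1 -addrA addrCA lerDl.
by rewrite addr_ge0 ?far_weight_ge0// mulr_ge0 ?powR_ge0 ?near_weight_ge0.
Qed.

Lemma measurable_near_weight r : measurable_fun setT (near_weight r).
Proof.
apply: measurable_fun_ifT => //.
  by apply: measurable_fun_ler => //; exact: normr_measurable.
by apply: (measurableT_comp (measurable_powR a)) => //; exact: normr_measurable.
Qed.

Lemma measurable_far_weight : measurable_fun setT far_weight.
Proof.
apply: measurable_fun_ifT => //.
  by apply: measurable_fun_ltr => //; exact: normr_measurable.
by apply: (measurableT_comp (measurable_powR _)) => //; exact: normr_measurable.
Qed.

Lemma cmeasurable_line y : cmeasurable setT (fun x : R => (x +i* y)%C).
Proof. by split => //=; exact: measurable_cst. Qed.

Lemma measurable_density eps y : measurable_fun setT (density eps y).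
Proof.
apply: measurable_funM; last first.
  by apply: (measurableT_comp (measurable_powR a)) => //; exact: normr_measurable.
apply: (measurableT_comp (measurable_powR p)) => //.
apply: measurable_cabs; have mz := cmeasurable_line y.
apply: cmeasurableM.
  apply: cmeasurable_cexp; apply: cmeasurableM; first exact: cmeasurable_cst.
  by apply: cmeasurable_clog; apply: cmeasurableD => //; exact: cmeasurable_cst.
apply: cmeasurableV; apply: cmeasurableB; first exact: cmeasurable_cst.
by apply: cmeasurableM => //; exact: cmeasurable_cst.
Qed.

Lemma measurable_region eps r y : measurable_fun setT (region eps r y).
Proof.
have mz : measurable_fun setT (fun x : R => cabs (x +i* y)%C).
  exact: measurable_cabs (cmeasurable_line y).
apply: measurable_and; apply: measurable_fun_ler => //.
by apply: measurable_funM.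
Qed.

Lemma integral_weights (C c1 c2 r1 r2 : R) : 0 <= C -> 0 <= c1 -> 0 <= c2 ->
  0 < r1 -> 0 < r2 ->
  (\int[leb]_x (C * (c1 * near_weight r1 x + c2 * near_weight r2 x + far_weight x))%:E <=
   (C * (c1 * (2 * (r1 `^ (a + 1) / (a + 1))) + c2 * (2 * (r2 `^ (a + 1) / (a + 1))) +
     2 * p^-1))%:E)%E.
Proof.
move=> C0 c10 c20 r10 r20.
have mn r : measurable_fun setT (EFin \o near_weight r).
  by apply/measurable_EFinP; exact: measurable_near_weight.
have mf : measurable_fun setT (EFin \o far_weight).
  by apply/measurable_EFinP; exact: measurable_far_weight.
have n0 r x : (0 <= (near_weight r x)%:E)%E by rewrite lee_fin near_weight_ge0.
have f0 x : (0 <= (far_weight x)%:E)%E by rewrite lee_fin far_weight_ge0.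
have cn0 c r x : 0 <= c -> (0 <= c%:E * (near_weight r x)%:E)%E.
  by move=> c0; apply: mule_ge0; [rewrite lee_fin|exact: n0].
have mcn c r : measurable_fun setT (fun x => (c%:E * (near_weight r x)%:E)%E).
  by apply: emeasurable_funM => //; exact: mn.
under eq_integral do rewrite EFinM !EFinD !EFinM.
rewrite ge0_integralZl_EFin//; last 2 first.
- by move=> x _; rewrite !adde_ge0 ?cn0.
- by apply: emeasurable_funD; [apply: emeasurable_funD; exact: mcn|exact: mf].
rewrite EFinM lee_wpmul2l ?lee_fin// ge0_integralD//; last 2 first.
- by move=> x _; rewrite !adde_ge0 ?cn0.
- by apply: emeasurable_funD; exact: mcn.
rewrite EFinD leeD//; last by apply: integral_far.
rewrite ge0_integralD//; last 4 first.
- by move=> x _; rewrite cn0.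
- exact: mcn.
- by move=> x _; rewrite cn0.
- exact: mcn.
rewrite EFinD leeD//.
- rewrite ge0_integralZl_EFin//; last exact: mn.
  by rewrite EFinM lee_wpmul2l ?lee_fin//; exact: integral_near0.
- rewrite ge0_integralZl_EFin//; last exact: mn.
  by rewrite EFinM lee_wpmul2l ?lee_fin//; exact: integral_near0.
Qed.

(* The mass outside [region], uniformly in [eps] and [y]. *)
Definition rest_bound r : R :=
  B `^ p * (r `^ (- (a + 1)) * (2 / (a + 1)) + r `^ (- (a + 1)) * (2 / (a + 1)) + 2 * p^-1).

Lemma integral_density_region eps r y : 0 < y -> 0 < eps -> 0 < r ->
  (\int[leb]_x (density eps y x)%:E <=
   \int[leb]_x (if region eps r y x then density eps y x else 0)%:E + (rest_bound r)%:E)%E.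
Proof.
move=> y0 e0 r0.
pose rest x := B `^ p * (eps `^ (- (a + 1)) * near_weight (eps / r) x +
    r `^ (- (a + 1)) * near_weight 1 x + far_weight x).
have rest0 x : 0 <= rest x.
  by rewrite mulr_ge0 ?powR_ge0// !addr_ge0 ?far_weight_ge0// mulr_ge0 ?powR_ge0 ?near_weight_ge0.
apply: (@le_trans _ _ (\int[leb]_x
   ((if region eps r y x then density eps y x else 0)%:E + (rest x)%:E))%E).
  apply: ge0_integral_mono => [x _|x _|x _]; rewrite -?EFinD ?lee_fin ?density_ge0//.
    by rewrite addr_ge0//; case: ifP => // _; rewrite density_ge0.
  split=> //; case: ifPn => [_|out]; first by rewrite lerDl.
  by rewrite add0r density_outside_region.
rewrite ge0_integralD//; last 4 first.
- by move=> x _; case: ifP => // _; rewrite lee_fin density_ge0.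
- apply/measurable_EFinP; apply: measurable_fun_ifT => //.
    exact: measurable_region.
  exact: measurable_density.
- by move=> x _; rewrite lee_fin.
- apply/measurable_EFinP; apply: measurable_funM; first exact: measurable_cst.
  apply: measurable_funD; last exact: measurable_far_weight.
  by apply: measurable_funD; apply: measurable_funM => //; exact: measurable_near_weight.
rewrite leeD2l//.
have h := @integral_weights (B `^ p) (eps `^ (- (a + 1))) (r `^ (- (a + 1))) (eps / r) 1
  (powR_ge0 _ _) (powR_ge0 _ _) (powR_ge0 _ _) (divr_gt0 e0 r0) ltr01.
apply: (le_trans h); rewrite /rest_bound powR1 lee_fin le_eqVlt; apply/orP; left; apply/eqP.
congr (_ * (_ + _ + _)); last by rewrite mul1r.
(* Here [eps] cancels, which makes the bound uniform. *)
have E : eps `^ (- (a + 1)) * (eps / r) `^ (a + 1) = r `^ (- (a + 1)).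
  rewrite powRM ?invr_ge0 ?ltW// mulrA -powRD ?(gt_eqF e0) ?implybT//.
  by rewrite addNr powRr0 mul1r -powR_inv1 ?ltW// -powRrM mulN1r.
by rewrite -E; field; rewrite gt_eqF.
Qed.

Lemma integral_density_le eps y : 0 < y -> 0 < eps ->
  (\int[leb]_x (density eps y x)%:E <=
   (B `^ p * (eps `^ (- (a + 1)) * (2 / (a + 1)) + 2 * p^-1))%:E)%E.
Proof.
move=> y0 e0.
have h := @integral_weights (B `^ p) (eps `^ (- (a + 1))) 0 1 1
  (powR_ge0 _ _) (powR_ge0 _ _) (lexx _) ltr01 ltr01.
apply: (le_trans _ (le_trans h _)); last first.
  by rewrite lee_fin powR1 !mul0r addr0 mul1r.
apply: ge0_integral_mono => [x _|x _|x _]; rewrite ?lee_fin ?density_ge0//.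
  rewrite mul0r addr0 mulr_ge0 ?powR_ge0// addr_ge0 ?far_weight_ge0//.
  by rewrite mulr_ge0 ?powR_ge0 ?near_weight_ge0.
by split=> //; rewrite mul0r addr0 density_le_weights.
Qed.

(** The constant c in the lower bound c/x at height eps. The two factors 3 come from |z + i eps| <=
    3x and |pole z| <= 3, valid for z = x + i eps with eps <= x <= 1. *)
Definition blowup : R := expR (- (`|xi| * pi)) `^ p * 3 `^ (- (a + 1)) * 3 `^ (- p).

Lemma blowup_gt0 : 0 < blowup.
Proof. by rewrite !mulr_gt0 ?powR_gt0// expR_gt0. Qed.

Lemma density_ge eps x : 0 < eps -> eps <= x -> x <= 1 ->
  blowup * x^-1 <= density eps eps x.
Proof.
move=> e0 ex x1; have x0 : 0 < x := lt_le_trans e0 ex.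
rewrite /density (gtr0_norm x0).
have zx : cabs (x +i* eps)%C <= 2 * x.
  rewrite (le_trans (cabs_le_ReIm _))//= !gtr0_norm//; lra.
have W3 : cabs ((x +i* eps)%C + (0 +i* eps)%C) <= 3 * x.
  by rewrite (le_trans (cabs_shift_le _ (ltW e0)))//; lra.
have P3 : cabs (pole (x +i* eps)%C) <= 3 by rewrite (le_trans (pole_le _))//; lra.
have e0' : 0 < complex.Im (x +i* eps)%C by [].
have W0 : 0 < cabs ((x +i* eps)%C + (0 +i* eps)%C).
  by rewrite cabs_gt0 upper_neq0// Im_shift_gt0 ?ltW.
have P0 : 0 < cabs (pole (x +i* eps)%C).
  by rewrite cabs_gt0 pole_neq0 ?ltW.
have -> : blowup * x^-1 = expR (- (`|xi| * pi)) `^ p * (3 * x) `^ (- (a + 1)) *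
    3 `^ (- p) * x `^ a.
  rewrite powRM ?ltW// -powR_inv1 ?ltW// /blowup.
  have -> : x `^ (- 1) = x `^ (- (a + 1)) * x `^ a.
    by rewrite -powRD ?(gt_eqF x0) ?implybT//; congr (_ `^ _); ring.
  ring.
rewrite ler_wpM2r ?powR_ge0//.
have := @testfun_ge R s xi eps (x +i* eps)%C e0' (ltW e0).
set W := cabs (_ + _) in W0 W3 *; set P := cabs (pole _) in P0 P3 *; set F := cabs _ => h.
apply: (@le_trans _ _ ((expR (- (`|xi| * pi)) * W `^ (- s) / P) `^ p)); last first.
  apply: ge0_ler_powR => //; first exact: ltW.
    by rewrite nnegrE !mulr_ge0 ?expR_ge0 ?powR_ge0 ?invr_ge0 ?ltW.
  by rewrite nnegrE cabs_ge0.
rewrite !powRM ?mulr_ge0 ?expR_ge0 ?powR_ge0 ?invr_ge0 ?(ltW P0)//.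
rewrite -powRrM mulNr divfK ?gt_eqF//.
rewrite -(@powR_inv1 _ P) ?(ltW P0)// -powRrM mulN1r.
apply: ler_pM; rewrite ?mulr_ge0 ?powR_ge0//.
- by rewrite -powRM ?(ltW x0)// ler_wpM2l ?powR_ge0// le_powRN// ltW.
- by rewrite le_powRN// ltW.
- exact: ltW.
Qed.

Lemma integral_density_ge eps : 0 < eps -> eps < 1 ->
  ((blowup * - ln eps)%:E <= \int[leb]_x (density eps eps x)%:E)%E.
Proof.
move=> e0 e1.
have -> : (blowup * - ln eps)%:E = (\int[leb]_(x in `[eps, 1%R]) (blowup%:E * (x^-1)%:E))%E.
  rewrite ge0_integralZl_EFin//.
  - by rewrite integral_inv// ln1 sub0r EFinM.
  - by move=> x; rewrite /= in_itv /= => /andP[ex _]; rewrite lee_fin invr_ge0 (le_trans _ ex)// ltW.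
  - by apply/measurable_EFinP; apply: measurable_inv.
  - exact: ltW blowup_gt0.
apply: ge0_integral_mono => [x|x _|x].
- rewrite /= in_itv /= => /andP[ex _]; rewrite -EFinM lee_fin.
  by rewrite mulr_ge0 ?invr_ge0 ?(ltW blowup_gt0)// (le_trans _ ex)// ltW.
- by rewrite lee_fin density_ge0.
- rewrite /= in_itv /= => /andP[ex x1]; split=> //.
  by rewrite -EFinM lee_fin density_ge.
Qed.

End Mass.

(** * Finiteness and blow-up of the Hardy norms *)

Section TestNorm.
Variables (R : realType) (p a xi : R).
Hypothesis p1 : 1 <= p.
Hypothesis a1 : -1 < a.
Implicit Types (eps k y : R).
Local Notation leb := (@lebesgue_measure R).
Local Notation s := ((a + 1) / p).

Let p0 : 0 < p. Proof. exact: lt_le_trans p1. Qed.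

Lemma poweR_root_EFin (x : R) : 0 <= x -> (((x `^ p)%:E `^ p^-1) = x%:E)%E.
Proof. by move=> x0; rewrite poweR_EFin -powRrM divff ?gt_eqF// powRr1. Qed.

Lemma le_poweR_root (u v : \bar R) : (0 <= u)%E -> (u <= v)%E ->
  (u `^ p^-1 <= v `^ p^-1)%E.
Proof.
move=> u0 uv; apply: gt0_ler_poweR => //; first by rewrite invr_ge0 ltW.
  by rewrite in_itv /= u0 leey.
by rewrite in_itv /= (le_trans u0 uv) leey.
Qed.

Lemma integral_density_fin_num eps y : 0 < y -> 0 < eps ->
  (\int[leb]_x (density p a xi eps y x)%:E)%E \is a fin_num.
Proof.
move=> y0 e0; rewrite ge0_fin_numE; last first.
  by apply: integral_ge0 => x _; rewrite lee_fin density_ge0.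
exact: le_lt_trans (integral_density_le xi p1 a1 y0 e0) (ltry _).
Qed.

Lemma hardy_norm_testfun_lty eps : 0 < eps ->
  (hardy_norm p a (testfun s xi eps) < +oo)%E.
Proof.
move=> e0; apply: (@le_lt_trans _ _
  (((expR (`|xi| * pi) `^ p * (eps `^ (- (a + 1)) * (2 / (a + 1)) + 2 * p^-1))%:E) `^ p^-1)%E);
  last by rewrite poweR_EFin ltry.
apply: ge_ereal_sup => _ [y y0 <-]; apply: le_poweR_root.
  by apply: integral_ge0 => x _; rewrite lee_fin density_ge0.
exact: integral_density_le.
Qed.

Lemma hardy_norm_testfun_ge eps : 0 < eps -> eps < 1 ->
  ((blowup p a xi * - ln eps)%:E `^ p^-1 <= hardy_norm p a (testfun s xi eps))%E.
Proof.
move=> e0 e1.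
apply: (@le_trans _ _ ((\int[leb]_x (density p a xi eps eps x)%:E) `^ p^-1)%E).
  apply: le_poweR_root; last exact: integral_density_ge.
  by rewrite lee_fin mulr_ge0 ?(ltW (blowup_gt0 _ _ _))// oppr_ge0 ln_le0// ltW.
by apply: ereal_sup_ubound; exists eps.
Qed.

Lemma integral_scaled_density eps k y : 0 <= k ->
  (\int[leb]_x (cabs (k%:C%C * testfun s xi eps (x +i* y)%C) `^ p * `|x| `^ a)%:E =
   (k `^ p)%:E * \int[leb]_x (density p a xi eps y x)%:E)%E.
Proof.
move=> k0; rewrite -ge0_integralZl_EFin ?powR_ge0//.
- apply: eq_integral => x _; rewrite -EFinM /density [in RHS]mulrA -powRM ?cabs_ge0//.
  by rewrite cabsM cabs_real ger0_norm.
- by move=> x _; rewrite lee_fin density_ge0.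
- by apply/measurable_EFinP; exact: measurable_density.
Qed.

Lemma hardy_norm_scaled_le eps k y : 0 < y -> 0 <= k -> 0 < eps ->
  ((\int[leb]_x (cabs (k%:C%C * testfun s xi eps (x +i* y)%C) `^ p * `|x| `^ a)%:E)
     `^ p^-1 <= k%:E * hardy_norm p a (testfun s xi eps))%E.
Proof.
move=> y0 k0 e0; rewrite integral_scaled_density// poweRM; last 2 first.
- by rewrite lee_fin powR_ge0.
- by apply: integral_ge0 => x _; rewrite lee_fin density_ge0.
rewrite poweR_root_EFin// lee_wpmul2l ?lee_fin//.
by apply: ereal_sup_ubound; exists y.
Qed.

End TestNorm.

(** * Lower bound for the operator norm *)

Section Assembly.
Variables (R : realType) (p a : R) (phi : R -> R[i]).
Hypothesis p1 : 1 <= p.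
Hypothesis a1 : -1 < a.
Hypothesis mphi : cmeasurable (`[0, +oo[ : set (leb_line R)) phi.
Hypothesis iphi : (\int[completed_lebesgue_measure]_(t in `]0%R, +oo[)
               (cabs (phi t) * t `^ ((a + 1) / p - 1))%:E < +oo)%E.
Local Notation leb := (@lebesgue_measure R).
Local Notation s := ((a + 1) / p).

Let p0 : 0 < p. Proof. exact: lt_le_trans p1. Qed.

Lemma measurable_leb (A : set R) : measurable A -> measurable (A : set (leb_line R)).
Proof. by move=> mA; exact: sub_caratheodory. Qed.

Lemma hausdorff_near_eigen (xi eta : R) : 0 < eta ->
  exists2 r, 0 < r <= 1 & forall eps k z, 0 < eps -> 0 < complex.Im z ->
    eps <= r * cabs z -> cabs z <= r ->
    (cabs (khat p a phi xi) - eta) * cabs (k * testfun s xi eps z) <=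
    cabs (hausdorff phi (fun z => k * testfun s xi eps z) z).
Proof.
have m0 : measurable (`]0, +oo[%classic : set (leb_line R)).
  by apply: measurable_leb; exact: measurable_itv.
have m0' : measurable (`[0, +oo[%classic : set (leb_line R)).
  by apply: measurable_leb; exact: measurable_itv.
have sub : (`]0, +oo[%classic : set (leb_line R)) `<=` `[0, +oo[%classic.
  by move=> x; rewrite /= !in_itv /= !andbT => /ltW.
have mphi' : cmeasurable (`]0, +oo[%classic : set (leb_line R)) phi.
  by case: mphi => mr mi; split; exact: measurable_funS m0' sub _.
have mid : measurable_fun (`]0, +oo[%classic : set (leb_line R))
    (fun t : leb_line R => (t : R)).
  by move=> _ Y mY; apply: measurableI => //; exact: measurable_leb.
have pos (t : leb_line R) : `]0, +oo[%classic t -> 0 < (t : R).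
  by rewrite /= in_itv /= andbT.
have s0 : 0 < s by rewrite divr_gt0// -ltrBlDr sub0r.
exact: (@dilation_average_testfun_close _ (leb_line R) R completed_lebesgue_measure
  `]0, +oo[%classic (fun t => t) s xi phi m0 mid pos s0 mphi' iphi eta).
Qed.

(** Of the loss 2 eta, one half pays for choosing a line that only nearly attains the norm, the
    other for discarding the mass outside [region]. The maximum with 0 makes the eigenvalue bound
    fit for taking p-th powers. *)
Lemma hardy_opnorm_ge (xi eta : R) : 0 < eta -> eta < 2^-1 ->
  ((Num.max 0 (cabs (khat p a phi xi) - eta) * (1 - 2 * eta))%:E <=
   hardy_opnorm p a (hausdorff phi))%E.
Proof.
move=> eta0 eta2; have [r /andP[r0 r1] close] := hausdorff_near_eigen xi eta0.
set kap := Num.max 0 _.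
have kap0 : 0 <= kap by rewrite le_max lexx.
(* The share of n^p that may be discarded, where n is the norm of the test function. *)
pose delta := (1 - eta) `^ p - (1 - 2 * eta) `^ p.
have delta0 : 0 < delta.
  by rewrite subr_gt0; apply: gt0_ltr_powR => //; rewrite ?nnegrE; lra.
have b0 := blowup_gt0 p a xi.
(* With eps = e^(-M) the norm satisfies n^p >= [blowup] M, so this M forces [rest_bound] <= [delta]
   n^p; the maximum with 1 ensures eps < 1. *)
pose M := Num.max 1 (rest_bound p a xi r / (delta * blowup p a xi)).
have M0 : 0 < M by rewrite lt_max ltr01.
pose eps := expR (- M).
have e0 : 0 < eps by exact: expR_gt0.
have e1 : eps < 1 by rewrite expR_lt1 oppr_lt0.
have lnM : - ln eps = M by rewrite /eps expRK opprK.
have restM : rest_bound p a xi r <= delta * (blowup p a xi * M).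
  have : rest_bound p a xi r / (delta * blowup p a xi) <= M by rewrite le_max lexx orbT.
  rewrite (ler_pdivrMr _ _ (mulr_gt0 delta0 b0)) => /le_trans; apply.
  by rewrite mulrC mulrA.
have Nlty := hardy_norm_testfun_lty xi p1 a1 e0.
have Nge := hardy_norm_testfun_ge xi p1 a1 e0 e1.
rewrite lnM poweR_EFin in Nge.
have bM0 : 0 < blowup p a xi * M := mulr_gt0 b0 M0.
set N := hardy_norm p a _ in Nlty Nge.
have Nfin : N \is a fin_num.
  by rewrite ge0_fin_numE// (le_trans _ Nge)// lee_fin powR_ge0.
have [n NE] : exists n : R, N = n%:E by exists (fine N); rewrite fineK.
rewrite NE lee_fin in Nge.
have n0 : 0 < n by rewrite (lt_le_trans _ Nge)// powR_gt0.
have nM : blowup p a xi * M <= n `^ p.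
  have -> : blowup p a xi * M = ((blowup p a xi * M) `^ p^-1) `^ p.
    by rewrite -powRrM mulVf ?gt_eqF// powRr1// ltW.
  by apply: ge0_ler_powR => //; rewrite ?nnegrE ?powR_ge0// ltW.
have [y y0 yN] : exists2 y : R, 0 < y &
    (((1 - eta) * n)%:E < (\int[leb]_x (density p a xi eps y x)%:E) `^ p^-1)%E.
  have en : 0 < eta * n by rewrite mulr_gt0.
  have [_ [y /= y0 <-] h] := ub_ereal_sup_adherent en Nfin.
  exists y => //; apply: le_lt_trans h.
  by rewrite -/(hardy_norm p a _) -/N NE -EFinB lee_fin mulrBl mul1r.
have Ifin := integral_density_fin_num xi p1 a1 y0 e0.
have Ile := integral_density_region xi p1 a1 y0 e0 r0.
have [I IE] : exists I : R, (\int[leb]_x (density p a xi eps y x)%:E = I%:E)%E.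
  by exists (fine (\int[leb]_x (density p a xi eps y x)%:E)); rewrite fineK.
rewrite IE in yN Ile Ifin.
have I0 : 0 <= I.
  by rewrite -lee_fin -IE integral_ge0// => x _; rewrite lee_fin density_ge0.
pose J := (\int[leb]_x (if region eps r y x then density p a xi eps y x else 0)%:E)%E.
have J0 : (0 <= J)%E.
  by apply: integral_ge0 => x _; case: ifP => // _; rewrite lee_fin density_ge0.
(* The chosen line carries at least ((1 - eta) n)^p, of which at most [delta] n^p lies outside
   [region]. *)
have Jge : ((((1 - 2 * eta) * n) `^ p)%:E <= J)%E.
  have IN : ((1 - eta) * n) `^ p <= I.
    have -> : I = (I `^ p^-1) `^ p by rewrite -powRrM mulVf ?gt_eqF// powRr1.
    move: yN; rewrite poweR_EFin lte_fin => /ltW h.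
    apply: ge0_ler_powR => //; rewrite ?nnegrE ?powR_ge0 ?(ltW p0)//.
    by rewrite mulr_ge0 ?(ltW n0)//; lra.
  have : (((1 - 2 * eta) * n) `^ p + rest_bound p a xi r <= I).
    rewrite (le_trans _ IN)// !powRM ?(ltW n0)//; try lra.
    have h : rest_bound p a xi r <= delta * n `^ p.
      by rewrite (le_trans restM)// ler_wpM2l// ltW.
    by rewrite (le_trans (lerD (lexx _) h))// /delta -mulrDl subrKC.
  rewrite -lee_fin EFinD => /le_trans/(_ Ile).
  by rewrite leeD2rE.
pose F z := (n^-1)%:C%C * testfun s xi eps z.
have nV0 : 0 <= n^-1 by rewrite invr_ge0 ltW.
have F1 : (hardy_norm p a F <= 1)%E.
  apply: ge_ereal_sup => _ [y' /= y'0 <-].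
  rewrite (le_trans (@hardy_norm_scaled_le R p a xi p1 eps n^-1 y' y'0 nV0 e0))//.
  by rewrite -/N NE -EFinM mulVf ?gt_eqF.
apply: (@le_trans _ _ (hardy_norm p a (hausdorff phi F))); last first.
  have hF : hardy p a F.
    split; first exact: (holomorphic_testfun e0).
    by rewrite (le_lt_trans F1)// ltry.
  by apply: ereal_sup_ubound; exists F; [split|].
apply: (@le_trans _ _ ((\int[leb]_x (cabs (hausdorff phi F (x +i* y)%C) `^ p *
    `|x| `^ a)%:E) `^ p^-1)%E); last by apply: ereal_sup_ubound; exists y.
have K0 : 0 <= kap * (1 - 2 * eta) by rewrite mulr_ge0//; lra.
rewrite -(poweR_root_EFin p1 K0); apply: le_poweR_root => //.
  by rewrite lee_fin powR_ge0.
(* After scaling by 1/n the comparison is pointwise: inside [region] it is the near-eigenfunction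
   bound, outside the left-hand integrand is 0. *)
apply: (@le_trans _ _ (((kap / n) `^ p)%:E * J)%E).
  have -> : kap * (1 - 2 * eta) = kap / n * ((1 - 2 * eta) * n).
    by field; rewrite gt_eqF.
  rewrite powRM ?EFinM ?lee_wpmul2l ?lee_fin ?powR_ge0// ?mulr_ge0// ?(ltW n0)//; lra.
rewrite -ge0_integralZl_EFin ?powR_ge0//; last 2 first.
- by move=> x _; case: ifP => // _; rewrite lee_fin density_ge0.
- apply/measurable_EFinP; apply: measurable_fun_ifT => //.
    exact: measurable_region.
  exact: measurable_density.
apply: ge0_integral_mono => [x _|x _|x _].
- by rewrite -EFinM lee_fin mulr_ge0 ?powR_ge0//; case: ifP => // _; rewrite density_ge0.
- by rewrite lee_fin mulr_ge0 ?powR_ge0.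
split=> //; rewrite -EFinM lee_fin; case: ifPn => [/andP[h1 h2]|_]; last first.
  by rewrite mulr0 mulr_ge0 ?powR_ge0.
rewrite /density mulrA ler_wpM2r ?powR_ge0//.
have kn0 : 0 <= kap / n by rewrite mulr_ge0.
rewrite -powRM ?cabs_ge0//.
apply: ge0_ler_powR; rewrite ?nnegrE ?(ltW p0) ?mulr_ge0 ?cabs_ge0//.
have -> : kap / n * cabs (testfun s xi eps (x +i* y)%C) = kap * cabs (F (x +i* y)%C).
  by rewrite /F cabsM cabs_real ger0_norm// mulrA.
have := close eps (n^-1)%:C%C (x +i* y)%C e0 y0 h1 h2.
rewrite -/(F _) /kap; case: (leP 0 (cabs (khat p a phi xi) - eta)) => _ //.
by rewrite mul0r cabs_ge0.
Qed.

End Assembly.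

Theorem corollary13 (R : realType) (p a : R) (phi : R -> R[i])
    (hp : 1 <= p) (ha : -1 < a)
    (mphi : cmeasurable (`[0, +oo[ : set (leb_line R)) phi)
    (iphi : (\int[completed_lebesgue_measure]_(t in `]0%R, +oo[)
               (cabs (phi t) * t `^ ((a + 1) / p - 1))%:E < +oo)%E) :
  (ereal_sup [set (cabs (khat p a phi xi))%:E | xi in [set: R]]
   <= hardy_opnorm p a (hausdorff phi))%E.
Proof.
apply: ge_ereal_sup => _ [xi _ <-]; apply/lee_addgt0Pr => e e0.
set kap := cabs _; have kap0 : 0 <= kap by exact: cabs_ge0.
(* Since kap - (kap - eta)(1 - 2 eta) = eta (1 + 2 kap) - 2 eta^2, this choice makes the total loss
   at most [e]; the cap 1/4 secures eta < 1/2. *)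
pose eta := Num.min 4^-1 (e / (1 + 2 * kap)).
have d0 : 0 < 1 + 2 * kap by lra.
have eta0 : 0 < eta by rewrite lt_min divr_gt0// andbT; lra.
have eta4 : eta <= 4^-1 by rewrite ge_min lexx.
have etae : eta * (1 + 2 * kap) <= e by rewrite -ler_pdivlMr// ge_min lexx orbT.
have eta2 : eta < 2^-1 by lra.
have := hardy_opnorm_ge hp ha mphi iphi xi eta0 eta2.
move=> /(leeD2r e%:E); apply: le_trans.
rewrite -EFinD lee_fin -/kap.
have : kap - eta <= Num.max 0 (kap - eta) by rewrite le_max lexx orbT.
by move: (Num.max _ _) => m hm; nra.
Qed.
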